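(* Let $d\ge6$ and let $\mathbf{X}$ be an isotropic unimodal Lévy process on $\mathbb{R}^d$ with Green function $G$. There is $C>0$, depending only on $d$, such that for all $x\in\mathbb{R}^d\setminus\{0\}$ \[ G(x)\le C\,|x|^{-d}h(|x|)^{-2}K_1(|x|). \]
   Context: An isotropic unimodal Lévy process on $\mathbb{R}^d$ is a pure-jump Lévy process $\mathbf{X}=(X_t)_{t\ge0}$, $X_0=0$, whose Lévy measure has a radial, radially non-increasing density $\nu$; for $d\ge3$ it is transient and $G(x)$ is the density of the absolutely continuous part of $A\mapsto\int_0^\infty\mathbb{P}(X_t\in A)\,\mathrm{d}t$. For $r>0$: $h(r)=\int_{\mathbb{R}^d}\min\{1,r^{-2}|y|^2\}\nu(y)\,\mathrm{d}y$; $\nu_1(s)=\int_{\mathbb{R}^{d-1}}\nu(s,y)\,\mathrm{d}y$ is the Lévy density of the one-dimensional projection, and $K_1(r)=r^{-2}\int_{-r}^{r}s^2\nu_1(s)\,\mathrm{d}s$.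
   Formalization: Since a density is determined only almost everywhere while the bound is claimed at every nonzero x, G is taken to be a radial, radially non-increasing version of the density; that such a version exists for every isotropic unimodal process is standard and is not proved here. *)

(* Defs.v *)
From HB Require Import structures.
From mathcomp Require Import all_boot all_order all_algebra.
From mathcomp Require Import all_classical all_reals all_analysis measurable_realfun.
Import Order.TTheory GRing.Theory Num.Theory.
Set Implicit Arguments. Unset Strict Implicit. Unset Printing Implicit Defensive.
Local Open Scope classical_set_scope.
Local Open Scope ring_scope.

(* Euclidean space: [Rd n] is R^(n+1), realised as nested pairs
   R * (R * ( ... * R)), with the product (= Borel) sigma-algebra.
   Thus R^d is [Rd d.-1] and R^d = R * R^(d-1) definitionally for d >= 2. *)
Section Euclid.
Context {R : realType}.

Fixpoint dispd (n : nat) : measure_display :=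
  match n with
  | 0 => sigma_display (R.-ocitv.-measurable)
  | S m => (sigma_display (R.-ocitv.-measurable), dispd m).-prod end.

Fixpoint Rd (n : nat) : measurableType (dispd n) :=
  match n return measurableType (dispd n) with
  | 0 => measurableTypeR R
  | S m => (measurableTypeR R * Rd m)%type end.

Fixpoint lebd (n : nat) : set (Rd n) -> \bar R :=
  match n return set (Rd n) -> \bar R with
  | 0 => lebesgue_measure
  | S m => (lebesgue_measure \x @lebd m)%E end.

Fixpoint zerod (n : nat) : Rd n :=
  match n return Rd n with
  | 0 => (0 : R)
  | S m => ((0 : R), @zerod m) end.

Fixpoint dotd (n : nat) : Rd n -> Rd n -> R :=
  match n return Rd n -> Rd n -> R with
  | 0 => fun x y => x * y
  | S m => fun x y => x.1 * y.1 + dotd x.2 y.2 end.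

Definition normd (n : nat) (x : Rd n) : R := Num.sqrt (dotd x x).

Definition iso_unimodal_levy_density (n : nat) (nu : Rd n -> R) : Prop :=
  [/\ measurable_fun setT nu,
      (forall x, 0 <= nu x),
      (forall x y, normd x = normd y -> nu x = nu y),
      (forall x y, 0 < normd x -> normd x <= normd y -> nu y <= nu x)
    & (\int[@lebd n]_y (Num.min 1 (normd y ^+ 2) * nu y)%:E < +oo)%E].

Definition psi (n : nat) (nu : Rd n -> R) (xi : Rd n) : \bar R :=
  (\int[@lebd n]_y ((1 - cos (dotd xi y)) * nu y)%:E)%E.

(* mu t is the law of X_t: its Fourier transform is exp(-t psi).
   (Pure jump, isotropic: no drift, no Gaussian part, symmetric.) *)
Definition levy_law (n : nat) (nu : Rd n -> R)
    (mu : R -> probability (Rd n) R) : Prop :=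
  forall t, 0 <= t -> forall xi : Rd n,
    (\int[mu t]_x (cos (dotd xi x))%:E = (expR (- (t * fine (psi nu xi))))%:E)%E
    /\ (\int[mu t]_x (sin (dotd xi x))%:E = 0)%E.

Definition Upot (n : nat) (mu : R -> probability (Rd n) R) (A : set (Rd n))
  : \bar R :=
  (\int[lebesgue_measure]_(t in [set t : R | (0 <= t)%R]) mu t A)%E.

(* G is a density of the absolutely continuous part of the potential
   measure (Lebesgue decomposition: the singular part lives on a
   Lebesgue-null set N). *)
Definition green_density (n : nat) (mu : R -> probability (Rd n) R)
    (G : Rd n -> \bar R) : Prop :=
  [/\ measurable_fun setT G,
      (forall x, (0 <= G x)%E)
    & exists N : set (Rd n), [/\ measurable N, @lebd n N = 0%E &
        forall A, measurable A ->
          Upot mu (A `\` N) = (\int[@lebd n]_(x in A) G x)%E]].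

Definition radial_nonincreasing (n : nat) (G : Rd n -> \bar R) : Prop :=
  (forall x y, normd x = normd y -> G x = G y) /\
  (forall x y, 0 < normd x -> normd x <= normd y -> (G y <= G x)%E).

Definition hfun (n : nat) (nu : Rd n -> R) (r : R) : R :=
  fine (\int[@lebd n]_y (Num.min 1 (r ^- 2 * normd y ^+ 2) * nu y)%:E)%E.

Definition nu1 (n : nat) : (Rd n -> R) -> R -> \bar R :=
  match n return (Rd n -> R) -> R -> \bar R with
  | 0 => fun nu s => (nu s)%:E
  | S m => fun nu s => (\int[@lebd m]_y (nu (s, y))%:E)%E end.

Definition K1 (n : nat) (nu : Rd n -> R) (r : R) : R :=
  fine ((r ^- 2)%:E *
        \int[lebesgue_measure]_(s in [set s : R | (- r <= s <= r)%R])
           ((s ^+ 2)%:E * nu1 nu s))%E.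

End Euclid.
Arguments Rd : clear implicits.
Arguments lebd : clear implicits.
Arguments zerod : clear implicits.

(* Main.v *)
Require Import Defs.
From HB Require Import structures.
From mathcomp Require Import all_boot all_order all_algebra.
From mathcomp Require Import all_classical all_reals all_analysis measurable_realfun.
From mathcomp Require Import ring lra.
Import Order.TTheory GRing.Theory Num.Theory.
Import numFieldNormedType.Exports.
Local Open Scope classical_set_scope.
Local Open Scope ring_scope.

(* Let p(xi) be the Levy-Khinchin exponent, r = |x|, and B a box inside the
   ball of radius r, away from the origin. As G is radially nonincreasing,
   r^d G(x) is at most a constant times the potential of B.

   The product g of the functions 2 (1 - cos y_i) / y_i^2 is the Fourier
   transform of the product T of triangle functions, and
   g(y) - g(2y) >= 0, with a uniform positive lower bound for y in B / r.
   Integrating this against the law of X_t and using T >= 0 bounds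
   P(X_t in B) by a multiple of the integral of
   T(xi) (exp(-t p(xi/r)) - exp(-t p(2xi/r)))^+, and then, by integration in
   t, the potential of B by that of T(xi) (p(2xi/r) - p(xi/r))^+ / p(xi/r)^2.

   After a rotation p(xi) is the integral of 1 - cos(|xi| y_1) against nu, and
   s |-> nu(s, z) is nonincreasing in |s|, so weights on the line are compared
   through their integrals over the intervals [-u, u]. On the support of T this
   gives p(2xi/r) - p(xi/r) <= C K_1(r) / |xi| and p(xi/r) >= c |xi|^2 h(r).
   What is left is the integral of T(xi) |xi|^(-5), finite for d >= 6. *)

(** Comparing two frequencies instead of using g alone is what produces K_1: over [-u, u] the
    integrals of 1 - cos(2bs) and 1 - cos(bs) share the term 2u, so their difference is cubic in u
    near 0 and at most 4/b for large u. The integral of the kernel of K_1 behaves in the same way,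
    saturating at u = r. With b = |xi|/r, matching 4/b against that saturated value costs the factor
    1/|xi|. The bound p(xi/r) >= c |xi|^2 h(r) can only hold for bounded xi, which is why T has
    compact support. Integration in t divides by the square of this bound, and |xi|^-1 times |xi|^-4
    is the power -5, integrable at the origin exactly when d > 5.

    T is integrated against 1 + cos in place of cos, so that every exchange of integrals is Tonelli
    for nonnegative functions; the added constant cancels in the difference of the two frequencies.

    The box has all coordinates in [r/(2d), r/d]. After division by r they are at most 1, where 1 -
    cos s >= s^2/4, and the lower end makes the gap uniform. *)

Lemma measurable_set_bool {d : measure_display} {T : measurableType d}
  (b : T -> bool) : measurable_fun setT b -> measurable [set x | b x].
Proof. by move=> mb; have := mb measurableT [set true] I; rewrite setTI. Qed.

(** * Lebesgue measure on nested pairs as a sigma-finite measure; Tonelli *)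

Section lebd_measure.
Context {R : realType}.

(** [lebd] is a bare set function defined by recursion, and each product is known to be a measure
    only once its second factor is a sigma-finite one. The induction therefore carries a packaged
    measure equal to [lebd], from which the canonical instances below are read off. *)
Lemma lebd_sigma_finite_measure n :
  exists m : {sigma_finite_measure set (Rd R n) -> \bar R},
    lebd R n = m :> (set (Rd R n) -> \bar R).
Proof.
elim: n => [|n [m mE]].
  by exists (@lebesgue_measure R : {sigma_finite_measure set _ -> \bar R}).
pose pm : {measure set (measurableTypeR R * Rd R n)%type -> \bar R} :=
  product_measure1 (@lebesgue_measure R) m.
have pmE : lebd R n.+1 = pm by rewrite /= mE.
have sfpm : sigma_finite setT pm.
  have /sigma_finiteP[F [TF ndF Foo]] := sigma_finiteT (@lebesgue_measure R).
  have /sigma_finiteP[G [TG ndG Goo]] := sigma_finiteT m.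
  exists (fun k => F k `*` G k).
    rewrite -setXTT TF TG predeqE => -[x y]; split.
      move=> [/= [i _ Fix] [k _ Gky]]; exists (maxn i k) => //; split.
      - by move: x Fix; exact/subsetPset/ndF/leq_maxl.
      - by move: y Gky; exact/subsetPset/ndG/leq_maxr.
    by move=> [k _ []/= ? ?]; split; exists k.
  move=> k; have [? ?] := Foo k; have [? ?] := Goo k.
  split; first exact: measurableX.
  by rewrite /pm/= product_measure1E// lte_mul_pinfty// ge0_fin_numE.
pose B := Measure_isSigmaFinite.Build _ _ _ (pm : set _ -> \bar R) sfpm.
pose sm : {sigma_finite_measure set (measurableTypeR R * Rd R n)%type -> \bar R}
  := HB.pack (Measure.sort pm) (Measure.class pm) B.
by exists sm.
Qed.

Let lebd0 n : lebd R n set0 = 0%E.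
Proof. by have [m ->] := lebd_sigma_finite_measure n; rewrite measure0. Qed.

Let lebd_ge0 n A : (0 <= lebd R n A)%E.
Proof. by have [m ->] := lebd_sigma_finite_measure n. Qed.

Let lebd_sigma_additive n : semi_sigma_additive (lebd R n).
Proof.
have [m ->] := lebd_sigma_finite_measure n.
exact: measure_semi_sigma_additive.
Qed.

HB.instance Definition _ n := isMeasure.Build _ _ _ (lebd R n)
  (@lebd0 n) (@lebd_ge0 n) (@lebd_sigma_additive n).

Let lebd_sigma_finite n : sigma_finite setT (lebd R n).
Proof.
have [m ->] := lebd_sigma_finite_measure n.
exact: sigma_finiteT.
Qed.

HB.instance Definition _ n := Measure_isSigmaFinite.Build _ _ _ (lebd R n)
  (@lebd_sigma_finite n).

Local Open Scope ereal_scope.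

Lemma integral_lebdS n (f : Rd R n.+1 -> \bar R) :
  measurable_fun setT f -> (forall y, 0 <= f y) ->
  \int[lebd R n.+1]_y f y = \int[lebesgue_measure]_s \int[lebd R n]_z f (s, z).
Proof. by move=> mf f0; exact: (@fubini_tonelli1 _ _ _ _ R lebesgue_measure (lebd R n) f). Qed.

Lemma integral_lebdS_sym n (f : Rd R n.+1 -> \bar R) :
  measurable_fun setT f -> (forall y, 0 <= f y) ->
  \int[lebd R n.+1]_y f y = \int[lebd R n]_z \int[lebesgue_measure]_s f (s, z).
Proof. by move=> mf f0; exact: (@fubini_tonelli2 _ _ _ _ R lebesgue_measure (lebd R n) f). Qed.

Lemma lebdS_setX n (A : set (measurableTypeR R)) (B : set (Rd R n)) :
  measurable A -> measurable B ->
  lebd R n.+1 (A `*` B) = lebesgue_measure A * lebd R n B.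
Proof. move=> mA mB. exact: (@product_measure1E _ _ _ _ R lebesgue_measure (lebd R n)). Qed.

End lebd_measure.

(** * Translations, shears and rotations preserving Lebesgue measure *)

Section rotations.
Context {R : realType}.

(** The base case of the nested pairs is not a pair; [hd] and [addhd] hide this, so that shears
    between the first two coordinates have one definition in every dimension. *)
Definition hd n : Rd R n -> R :=
  match n return Rd R n -> R with
  | 0 => id
  | S m => fst end.

Definition addhd n (t : R) : Rd R n -> Rd R n :=
  match n return Rd R n -> Rd R n with
  | 0 => fun y => (y : R) + t
  | S m => fun y => (y.1 + t, y.2) end.

Lemma hd_addhd n t (y : Rd R n) : hd n (addhd n t y) = hd n y + t.
Proof. by case: n y. Qed.

Lemma dotd_addhd n t (y : Rd R n) :
  dotd (addhd n t y) (addhd n t y) = dotd y y + 2 * t * hd n y + t ^+ 2.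
Proof. by case: n y => [|n] y /=; ring. Qed.

Lemma dotd_ge0 n (y : Rd R n) : 0 <= dotd y y.
Proof.
by elim: n y => [|n ih] y /=; rewrite ?addr_ge0// -expr2 sqr_ge0.
Qed.

Lemma normd_ge0 n (y : Rd R n) : 0 <= normd y.
Proof. exact: sqrtr_ge0. Qed.

Lemma sqr_normd n (y : Rd R n) : normd y ^+ 2 = dotd y y.
Proof. by rewrite sqr_sqrtr// dotd_ge0. Qed.

Lemma sqr_hd_le n (y : Rd R n) : hd n y ^+ 2 <= dotd y y.
Proof. by case: n y => [|n] y /=; rewrite expr2// lerDl dotd_ge0. Qed.

Lemma measurable_hd n : measurable_fun setT (hd n).
Proof. by case: n => [|n] /=; [exact: measurable_id|exact: measurable_fst]. Qed.

Section measurable_into.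
Context {d : measure_display} {T : measurableType d}.

Lemma measurable_dotd n (f g : T -> Rd R n) :
  measurable_fun setT f -> measurable_fun setT g ->
  measurable_fun setT (fun t => dotd (f t) (g t)).
Proof.
elim: n f g => [|n ih] f g mf mg /=; first exact: measurable_funM.
apply: measurable_funD.
  by apply: measurable_funM;
    [exact: (measurableT_comp measurable_fst mf)
    |exact: (measurableT_comp measurable_fst mg)].
by apply: ih; [exact: (measurableT_comp measurable_snd mf)
              |exact: (measurableT_comp measurable_snd mg)].
Qed.

Lemma measurable_normd n (f : T -> Rd R n) :
  measurable_fun setT f -> measurable_fun setT (fun t => normd (f t)).
Proof.
move=> mf; apply: (measurableT_comp (f := @Num.sqrt R)).
  by apply: continuous_measurable_fun; exact: sqrt_continuous.
exact: measurable_dotd.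
Qed.

Lemma measurable_addhd n (a : T -> R) (f : T -> Rd R n) :
  measurable_fun setT a -> measurable_fun setT f ->
  measurable_fun setT (fun t => addhd n (a t) (f t)).
Proof.
case: n f => [|n] f ma mf /=; first exact: measurable_funD.
apply/measurable_fun_pairP; split.
  apply: measurable_funD => //.
  exact: (measurableT_comp measurable_fst mf).
exact: (measurableT_comp measurable_snd mf).
Qed.

End measurable_into.

Local Open Scope ereal_scope.

Lemma lebesgue_measureD (c : R) (A : set R) : measurable A ->
  pushforward lebesgue_measure ((fun x => (x + c)%R) : _ -> measurableTypeR R) A
  = lebesgue_measure A.
Proof.
have mc : measurable_fun setT
    ((fun x => (x + c)%R) : measurableTypeR R -> measurableTypeR R).
  exact: measurable_funD.
move=> mA; apply/esym.
pose B := isMeasurableFun.Build _ _ _ _ _ mc.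
pose f : {mfun (measurableTypeR R) >-> (measurableTypeR R)} := HB.pack (fun x : R => (x + c)%R) B.
rewrite -[pushforward _ _]/(pushforward lebesgue_measure f).
apply/lebesgue_measure_unique => //= _ [[a b]] _ <-.
rewrite /pushforward.
have -> : (fun x : R => (x + c)%R) @^-1` `]a, b] = `](a - c)%R, (b - c)%R]%classic.
  by apply/seteqP; split=> x /=; rewrite !in_itv/= ltrBlDr lerBrDr.
rewrite /= !lebesgue_measure_itv/= !lte_fin ltrD2r; case: ifP => // _.
by rewrite -!EFinB; congr EFin; ring.
Qed.

Lemma ge0_integral_translation (c : R) (f : R -> \bar R) :
  measurable_fun setT f -> (forall x, 0 <= f x) ->
  \int[lebesgue_measure]_x f (x + c)%R = \int[lebesgue_measure]_x f x.
Proof.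
move=> mf f0.
have mc : measurable_fun setT
    ((fun x => (x + c)%R) : measurableTypeR R -> measurableTypeR R).
  exact: measurable_funD.
transitivity (\int[pushforward lebesgue_measure
    ((fun x => (x + c)%R) : _ -> measurableTypeR R)]_x f x).
  by rewrite ge0_integral_pushforward// preimage_setT.
by apply: eq_measure_integral => A mA _; exact: lebesgue_measureD.
Qed.

(** Invariance is expressed by integrals of nonnegative functions and not by measures of sets:
    composition is then immediate, and a map acting on one factor is handled by Tonelli. *)
Definition preserves_lebd n (T : Rd R n -> Rd R n) :=
  measurable_fun setT T /\
  forall f : Rd R n -> \bar R, measurable_fun setT f -> (forall y, 0 <= f y) ->
    \int[lebd R n]_y f (T y) = \int[lebd R n]_y f y.

Lemma preserves_lebd_comp n (S T : Rd R n -> Rd R n) :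
  preserves_lebd n S -> preserves_lebd n T -> preserves_lebd n (S \o T).
Proof.
move=> [mS iS] [mT iT]; split; first exact: measurableT_comp.
move=> f mf f0; rewrite -(iS f mf f0).
apply: (iT (f \o S)) => [|y]; last exact: f0.
exact: measurableT_comp mf mS.
Qed.

Lemma preserves_lebd_addhd n t : preserves_lebd n (addhd n t).
Proof.
have ma m : measurable_fun setT (addhd m t).
  by apply: measurable_addhd => //; exact: measurable_id.
split=> // f mf f0; case: n f mf f0 => [|n] f mf f0.
  exact: ge0_integral_translation.
rewrite !integral_lebdS_sym//; last exact: (measurableT_comp mf (ma n.+1)).
apply: eq_integral => z _ /=.
apply: (ge0_integral_translation t (fun s => f (s, z))) => //.
exact: (measurableT_comp mf (pair2_measurable z)).
Qed.

Definition shear1 n (c : R) (y : Rd R n.+1) : Rd R n.+1 :=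
  ((y.1 + c * hd n y.2)%R, y.2).

Definition shear2 n (c : R) (y : Rd R n.+1) : Rd R n.+1 :=
  (y.1, addhd n (c * y.1)%R y.2).

Lemma preserves_lebd_shear1 n c : preserves_lebd n.+1 (shear1 n c).
Proof.
have m1 : measurable_fun setT (shear1 n c).
  apply/measurable_fun_pairP; split; last exact: measurable_snd.
  apply: measurable_funD; first exact: measurable_fst.
  apply: measurable_funM => //.
  by apply: (measurableT_comp (measurable_hd n)); exact: measurable_snd.
split=> // f mf f0.
rewrite !integral_lebdS_sym//; last exact: (measurableT_comp mf m1).
apply: eq_integral => z _ /=.
apply: (ge0_integral_translation (c * hd n z)%R (fun s => f (s, z))) => //.
exact: (measurableT_comp mf (pair2_measurable z)).
Qed.

Lemma preserves_lebd_shear2 n c : preserves_lebd n.+1 (shear2 n c).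
Proof.
have m2 : measurable_fun setT (shear2 n c).
  apply/measurable_fun_pairP; split; first exact: measurable_fst.
  apply: measurable_addhd; last exact: measurable_snd.
  by apply: measurable_funM => //; exact: measurable_fst.
split=> // f mf f0.
rewrite !integral_lebdS//; last exact: (measurableT_comp mf m2).
apply: eq_integral => s _ /=.
apply: ((preserves_lebd_addhd n (c * s)%R).2 (fun z => f (s, z))) => //.
exact: (measurableT_comp mf (pair1_measurable s)).
Qed.

Lemma preserves_lebd_snd n (T : Rd R n -> Rd R n) : preserves_lebd n T ->
  preserves_lebd n.+1 (fun y => (y.1, T y.2)).
Proof.
move=> [mT iT].
have m2 : measurable_fun setT (fun y : Rd R n.+1 => (y.1, T y.2) : Rd R n.+1).
  apply/measurable_fun_pairP; split; first exact: measurable_fst.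
  by apply: (measurableT_comp mT); exact: measurable_snd.
split=> // f mf f0.
rewrite !integral_lebdS//; last exact: (measurableT_comp mf m2).
apply: eq_integral => s _ /=.
apply: (iT (fun z => f (s, z))) => //.
exact: (measurableT_comp mf (pair1_measurable s)).
Qed.

Local Open Scope ring_scope.

(* A plane rotation is a product of three shears, and every shear preserves
   Lebesgue measure by Tonelli and translation invariance. *)
Lemma rotation_to_axis n (xi : Rd R n) :
  exists (T : Rd R n -> Rd R n) (eta : R),
    [/\ preserves_lebd n T, forall y, dotd (T y) (T y) = dotd y y,
        forall y, dotd xi (T y) = eta * hd n y & eta ^+ 2 = dotd xi xi].
Proof.
elim: n xi => [|n ih] xi.
  (* On the line [eta] is [xi] itself, possibly negative; this is why only its square is
     controlled. *)
  by exists id, (xi : R).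
have [T' [e' [pT' nT' dT' eT']]] := ih xi.2.
pose U (y : Rd R n.+1) : Rd R n.+1 := (y.1, T' y.2).
have pU : preserves_lebd n.+1 U by exact: preserves_lebd_snd.
have nU y : dotd (U y) (U y) = dotd y y by rewrite /= nT'.
have dU y : dotd xi (U y) = xi.1 * y.1 + e' * hd n y.2 by rewrite /= dT'.
have xiE : dotd xi xi = xi.1 ^+ 2 + e' ^+ 2 by rewrite /= -eT' expr2.
(* If [e'] vanishes, no rotation in the first two coordinates is left to do, and the shear
   coefficient below would divide by 0. *)
have [e'0|e'0] := eqVneq e' 0.
  exists U, (xi.1 : R); split => //.
    by move=> y; rewrite dU e'0 mul0r addr0.
  by rewrite xiE e'0 expr0n addr0.
pose rho := Num.sqrt (dotd xi xi).
have rho2 : rho ^+ 2 = xi.1 ^+ 2 + e' ^+ 2 by rewrite /rho sqr_sqrtr ?dotd_ge0.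
have rho0 : rho != 0.
  apply: contra_neq e'0 => r0; move: rho2; rewrite r0 expr0n/= => /eqP.
  rewrite eq_sym paddr_eq0 ?sqr_ge0// => /andP[_].
  by rewrite sqrf_eq0 => /eqP.
pose c := xi.1 / rho; pose s := e' / rho.
have s0 : s != 0 by rewrite mulf_neq0// invr_eq0.
have cs : c ^+ 2 + s ^+ 2 = 1.
  by rewrite /c /s !expr_div_n -mulrDl -rho2 divff// expf_neq0.
(* With c and s the cosine and sine of the angle, this is minus the tangent of half the angle, the
   coefficient of the two outer shears. *)
pose t := (c - 1) / s.
have ts : t * s = c - 1 by rewrite /t divfK.
have tc : t * (1 + c) = - s.
  apply: (mulIf s0); rewrite mulrAC ts; move: cs; rewrite !expr2 => cs.
  transitivity (c * c - 1); first ring.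
  by rewrite -cs; ring.
pose V := shear1 n t \o (shear2 n s \o shear1 n t).
have pV : preserves_lebd n.+1 V.
  apply: preserves_lebd_comp; first exact: preserves_lebd_shear1.
  apply: preserves_lebd_comp; first exact: preserves_lebd_shear2.
  exact: preserves_lebd_shear1.
have V1 y : (V y).1 = c * y.1 - s * hd n y.2.
  rewrite /V/= hd_addhd.
  transitivity ((1 + t * s) * y.1 + t * (2 + t * s) * hd n y.2); first ring.
  by rewrite ts -mulNr -tc; ring.
have V2 y : hd n (V y).2 = s * y.1 + c * hd n y.2.
  rewrite /V/= hd_addhd.
  transitivity (s * y.1 + (1 + t * s) * hd n y.2); first ring.
  by rewrite ts; ring.
have nV y : dotd (V y) (V y) = dotd y y.
  have -> : dotd (V y) (V y) = (V y).1 * (V y).1 + dotd (V y).2 (V y).2 by [].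
  rewrite V1 {1 2}/V/= dotd_addhd.
  set w := s * (y.1 + t * hd n y.2).
  have -> : w = s * y.1 + (c - 1) * hd n y.2 by rewrite /w -ts; ring.
  move: cs; rewrite !expr2 => cs.
  transitivity ((c * c + s * s) * (y.1 * y.1 + hd n y.2 * hd n y.2)
                - hd n y.2 * hd n y.2 + dotd y.2 y.2); first ring.
  by rewrite cs; ring.
exists (U \o V), rho; split.
- exact: preserves_lebd_comp.
- by move=> y; rewrite /comp nU nV.
- move=> y; rewrite /comp dU V1 V2.
  transitivity ((xi.1 * c + e' * s) * y.1 + (e' * c - xi.1 * s) * hd n y.2).
    by ring.
  have -> : e' * c - xi.1 * s = 0 by rewrite /c /s; field.
  have -> : xi.1 * c + e' * s = rho.
    rewrite /c /s !mulrA -mulrDl -!expr2 -rho2 expr2 mulfK//.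
  by rewrite mul0r addr0.
- by rewrite rho2 xiE.
Qed.

End rotations.

(** * Comparing weights on the line through their integrals over [-u, u] *)

Section majorization.
Context {R : realType}.
Local Notation leb := (@lebesgue_measure R).

Section lower_set.
Variables (k l : R -> R).
Hypotheses (mk : measurable_fun setT k) (ml : measurable_fun setT l).
Hypotheses (k0 : forall s, 0 <= k s) (l0 : forall s, 0 <= l s).
Hypothesis kl : forall u, 0 <= u ->
  (\int[leb]_(s in `[(- u)%R, u]) (k s)%:E <= \int[leb]_(s in `[(- u)%R, u]) (l s)%:E)%E.

Lemma majorizationT : (\int[leb]_s (k s)%:E <= \int[leb]_s (l s)%:E)%E.
Proof.
pose F (i : nat) := `[(- i%:R : R), i%:R]%classic.
have nF : nondecreasing_seq F.
  move=> i j ij; apply/subsetPset => x; rewrite /F /= !in_itv/= => /andP[ix xi].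
  have ijR : i%:R <= j%:R :> R by rewrite ler_nat.
  by apply/andP; split; lra.
have UF : \bigcup_i F i = setT.
  apply/seteqP; split => // x _; exists (Num.truncn `|x|).+1 => //.
  rewrite /F /= in_itv/=; have := truncnS_gt `|x|.
  by rewrite ltr_norml => /andP[/ltW -> /ltW ->].
have cv (f : R -> R) : measurable_fun setT f -> (forall s, 0 <= f s) ->
    (\int[leb]_(s in F i) (f s)%:E)%E @[i --> \oo] --> (\int[leb]_s (f s)%:E)%E.
  move=> mf f0; rewrite -UF; apply: ge0_nondecreasing_set_cvg_integral => //.
  - by move=> i; exact: measurable_itv.
  - by move=> i; apply/measurable_EFinP; exact: measurable_funTS.
  - by move=> i x _; rewrite lee_fin.
rewrite -(cvg_lim _ (cv k mk k0))// -(cvg_lim _ (cv l ml l0))//.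
apply: lee_lim.
- by apply/cvg_ex; exists (\int[leb]_s (k s)%:E)%E; exact: cv.
- by apply/cvg_ex; exists (\int[leb]_s (l s)%:E)%E; exact: cv.
- by near=> i; apply: kl.
Unshelve. all: by end_near. Qed.

(** Such a set is empty, the whole line or an interval [-u, u], up to three points: the origin,
    about which the condition says nothing, and the ends, where the supremum u of |s| may or may not
    be attained. *)
Lemma majorization_lower_set (S : set (measurableTypeR R)) : measurable S ->
  (forall s s', 0 < `|s| -> `|s| <= `|s'| -> S s' -> S s) ->
  (\int[leb]_(s in S) (k s)%:E <= \int[leb]_(s in S) (l s)%:E)%E.
Proof.
move=> mS lowS.
(* [S] may be replaced by any set that agrees with it off a countable, hence null, set. *)
have eqN (A N : set (measurableTypeR R)) : measurable A -> countable N -> S `\` N = A `\` N ->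
    (\int[leb]_(s in A) (k s)%:E <= \int[leb]_(s in A) (l s)%:E ->
     \int[leb]_(s in S) (k s)%:E <= \int[leb]_(s in S) (l s)%:E)%E.
  move=> mA cN SA.
  have N0 : leb N = 0%E by exact: countable_lebesgue_measure0.
  have mN : measurable N by by apply: countable_measurable => // t; exact: measurable_set1.
  have dropN (f : R -> R) (D : set (measurableTypeR R)) : measurable D ->
      measurable_fun setT f -> (forall s, 0 <= f s) ->
      (\int[leb]_(s in D) (f s)%:E = \int[leb]_(s in D `\` N) (f s)%:E)%E.
    move=> mD mf f0; apply: ge0_negligible_integral => //.
      by apply/measurable_EFinP; exact: measurable_funTS.
    by move=> x _; rewrite lee_fin.
  by rewrite !(dropN _ S)// SA -!(dropN _ A).
have [Sub|Sub] := pselect (forall u : R, exists2 s, S s & u < `|s|).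
  apply: (eqN setT [set 0]) => //; last exact: majorizationT.
  rewrite setTD; apply/seteqP; split => x /=; first by case.
  move=> /eqP x0; split; last exact/eqP.
  have [s Ss xs] := Sub `|x|.
  by apply: (lowS _ s) => //; rewrite ?normr_gt0// ltW.
have [->|/set0P[s0 Ss0]] := eqVneq S set0; first by rewrite !integral_set0.
have hsS : has_sup [set `|s| | s in S].
  split; first by exists `|s0|, s0.
  move/existsNP: Sub => [u uP]; exists u => _ [s Ss <-].
  by rewrite leNgt; apply/negP => us; apply: uP; exists s.
set u := sup [set `|s| | s in S].
have Su s : S s -> `|s| <= u.
  by move=> Ss; apply: sup_upper_bound => //; exists s.
have u0 : 0 <= u by apply: le_trans (Su _ Ss0).
apply: (eqN `[(- u)%R, u]%classic [set 0; u; - u]) => //; last exact: kl.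
  by apply/finite_set_countable.
apply/seteqP; split => x /= [xS xN]; split => //.
  by rewrite in_itv/= -ler_norml; exact: Su.
move: xS; rewrite in_itv/= -ler_norml le_eqVlt => /orP[/eqP xu|xu].
  exfalso; apply: xN; move: xu; have [x0|x0] := leP 0 x; last move=> <-.
    by rewrite ger0_norm// => ->; left; right.
  by right; rewrite ltr0_norm// opprK.
have x0 : 0 < `|x| by rewrite normr_gt0; apply/eqP => x0; apply: xN; do 2 left.
have [_ [s Ss <-] xs] := sup_gt hsS.1 xu.
by apply: (lowS _ s) => //; exact: ltW.
Qed.

End lower_set.

Lemma integral_mkbool (b : measurableTypeR R -> bool) (f : R -> R) :
  (\int[leb]_(s in [set s | b s]) (f s)%:E
   = \int[leb]_s (if b s then f s else 0)%:E)%E.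
Proof.
rewrite integral_mkcond; apply: eq_integral => s _; rewrite patchE.
case: ifPn => [/set_mem/= ->//|/negP nb]; case: ifPn => // bs.
by case: nb; exact: mem_set.
Qed.

(** [phi s] is the length of [0, phi s); Tonelli then exchanges s and the level t. *)
Lemma layer_cake (k phi : measurableTypeR R -> R) :
  measurable_fun setT k -> (forall s, 0 <= k s) ->
  measurable_fun setT phi -> (forall s, 0 <= phi s) ->
  (\int[leb]_s (k s * phi s)%:E
   = \int[leb]_t \int[leb]_(s in [set s | (0 <= t < phi s)%R]) (k s)%:E)%E.
Proof.
move=> mk k0 mphi phi0.
pose b (z : measurableTypeR R * measurableTypeR R) := (0 <= z.2) && (z.2 < phi z.1).
have mb : measurable_fun setT b.
  apply: measurable_and; first exact: (measurable_fun_ler (measurable_cst _) measurable_snd).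
  apply: (measurable_fun_ltr measurable_snd).
  exact: (measurableT_comp mphi measurable_fst).
pose F z := (if b z then k z.1 else 0)%:E.
have mF : measurable_fun setT F.
  apply/measurable_EFinP; apply: measurable_fun_ifT => //.
  exact: (measurableT_comp mk measurable_fst).
have F0 z : (0 <= F z)%E by rewrite lee_fin; case: ifPn.
transitivity (\int[leb]_s \int[leb]_t F (s, t))%E.
  apply: eq_integral => s _.
  transitivity (\int[leb]_(t in [set t | b (s, t)]) cst (k s)%:E t)%E; last first.
    exact: (integral_mkbool (fun t => b (s, t)) (cst (k s))).
  rewrite integral_cst; last first.
    by apply: (@measurable_set_bool _ _ (fun t => b (s, t))); exact: (measurableT_comp mb).
  rewrite EFinM; congr (_ * _)%E; apply/esym.
  transitivity (leb `[0, phi s[%classic).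
    by congr leb; apply/seteqP; split => t; rewrite /= in_itv.
  rewrite lebesgue_measure_itv/= lte_fin.
  by case: ltgtP (phi0 s) => // [_ _|<-]; rewrite ?sube0.
rewrite fubini_tonelli//; apply: eq_integral => t _.
by rewrite integral_mkbool.
Qed.

(** Every level set of [phi] is closed under moving towards the origin, so the inequality already
    holds for each level in the layer-cake formula. *)
Lemma majorization (k l phi : measurableTypeR R -> R) :
  measurable_fun setT k -> (forall s, 0 <= k s) ->
  measurable_fun setT l -> (forall s, 0 <= l s) ->
  measurable_fun setT phi -> (forall s, 0 <= phi s) ->
  (forall s s', 0 < `|s| -> `|s| <= `|s'| -> phi s' <= phi s) ->
  (forall u, 0 <= u ->
  (\int[leb]_(s in `[(- u)%R, u]) (k s)%:E <= \int[leb]_(s in `[(- u)%R, u]) (l s)%:E)%E) ->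
  (\int[leb]_s (k s * phi s)%:E <= \int[leb]_s (l s * phi s)%:E)%E.
Proof.
move=> mk k0 ml l0 mphi phi0 dphi kl; rewrite !layer_cake//.
have mb : measurable_fun setT (fun z : measurableTypeR R * measurableTypeR R =>
    (0 <= z.2) && (z.2 < phi z.1)).
  apply: measurable_and; first exact: (measurable_fun_ler (measurable_cst _) measurable_snd).
  apply: (measurable_fun_ltr measurable_snd).
  exact: (measurableT_comp mphi measurable_fst).
have mint (f : measurableTypeR R -> R) : measurable_fun setT f -> (forall s, 0 <= f s) ->
  measurable_fun setT (fun t : measurableTypeR R =>
    \int[leb]_(s in [set s | (0 <= t < phi s)%R]) (f s)%:E)%E.
  move=> mf f0.
  under eq_fun do rewrite integral_mkbool.
  apply: (measurable_fun_fubini_tonelli_G (m1 := leb)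
    (fun z : measurableTypeR R * measurableTypeR R =>
      (if (0 <= z.2) && (z.2 < phi z.1) then f z.1 else 0)%:E)).
    apply/measurable_EFinP; apply: measurable_fun_ifT => //.
    exact: (measurableT_comp mf measurable_fst).
  by move=> z; rewrite lee_fin; case: ifPn.
apply: ge0_le_integral => //.
- by move=> t _; apply: integral_ge0 => s _; rewrite lee_fin.
- exact: mint.
- exact: mint.
move=> t _; apply: majorization_lower_set => //.
  by apply: (@measurable_set_bool _ _ (fun s => (0 <= t) && (t < phi s)));
    exact: (measurableT_comp mb (pair2_measurable t)).
move=> s s' s0 ss' /= /andP[-> /lt_le_trans->//].
exact: dphi.
Qed.

(** The slices s |-> nu(s, z) play the role of [phi]. For s different from 0 the point (s, z) has
    positive norm even when z = 0, so exempting s = 0 in [majorization] matches the exemption of the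
    origin for [nu]. *)
Lemma majorization_lebd n (k l : measurableTypeR R -> R) (nu : Rd R n.+1 -> R) :
  measurable_fun setT k -> (forall s, 0 <= k s) ->
  measurable_fun setT l -> (forall s, 0 <= l s) ->
  measurable_fun setT nu -> (forall y, 0 <= nu y) ->
  (forall x y, 0 < normd x -> normd x <= normd y -> nu y <= nu x) ->
  (forall u, 0 <= u ->
  (\int[leb]_(s in `[(- u)%R, u]) (k s)%:E <= \int[leb]_(s in `[(- u)%R, u]) (l s)%:E)%E) ->
  (\int[lebd R n.+1]_y (k y.1 * nu y)%:E <= \int[lebd R n.+1]_y (l y.1 * nu y)%:E)%E.
Proof.
move=> mk k0 ml l0 mnu nu0 dnu kl.
have mf (f : measurableTypeR R -> R) : measurable_fun setT f ->
    measurable_fun setT (fun y : Rd R n.+1 => (f y.1 * nu y)%:E).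
  move=> mf; apply/measurable_EFinP; apply: measurable_funM => //.
  exact: (measurableT_comp mf measurable_fst).
rewrite !integral_lebdS_sym; [|exact: mf|by move=> y; rewrite lee_fin mulr_ge0
  |exact: mf|by move=> y; rewrite lee_fin mulr_ge0].
apply: ge0_le_integral => //.
- by move=> z _; apply: integral_ge0 => s _; rewrite lee_fin mulr_ge0.
- apply: (measurable_fun_fubini_tonelli_G (m1 := leb)
    (fun y : Rd R n.+1 => (k y.1 * nu y)%:E)); first exact: mf.
  by move=> y; rewrite lee_fin mulr_ge0.
- apply: (measurable_fun_fubini_tonelli_G (m1 := leb)
    (fun y : Rd R n.+1 => (l y.1 * nu y)%:E)); first exact: mf.
  by move=> y; rewrite lee_fin mulr_ge0.
move=> z _; apply: (majorization k l (fun s => nu (s, z))) => //.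
  exact: (measurableT_comp mnu (pair2_measurable z)).
move=> s s' s0 ss'.
have sq : s ^+ 2 <= s' ^+ 2.
  by rewrite -[leLHS]real_normK ?num_real// -[leRHS]real_normK ?num_real// lerXn2r ?nnegrE.
apply: dnu.
  rewrite sqrtr_gt0 /= ltr_pwDl ?dotd_ge0// -expr2.
  by rewrite exprn_even_gt0//= -normr_gt0.
by apply: ler_wsqrtr; rewrite /= lerD2r -!expr2.
Qed.

End majorization.

(** * Bounds on sine and cosine; the triangle function and its Fourier transform *)

Section calculus.
Context {R : realType}.
Local Notation leb := (@lebesgue_measure R).
Implicit Types (f g F : R -> R) (x a b c : R).

(** A plain proposition for which the rules below are stated on explicit lambda terms; [der] applies
    them syntactically and leaves the equality with the claimed derivative to [ring] or [field]. *)
Definition hasder f x (l : R) : Prop := is_derive x 1 f l.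

Let dC c x : hasder (fun=> c) x 0.
Proof. exact: is_derive_cst. Qed.

Let dI x : hasder (fun t => t) x 1.
Proof. exact: is_derive_id. Qed.

Let dD f g x (df dg : R) : hasder f x df -> hasder g x dg ->
  hasder (fun t => f t + g t) x (df + dg).
Proof. exact: is_deriveD. Qed.

Let dN f x (df : R) : hasder f x df -> hasder (fun t => - f t) x (- df).
Proof. exact: is_deriveN. Qed.

Let dM f g x (df dg : R) : hasder f x df -> hasder g x dg ->
  hasder (fun t => f t * g t) x (f x * dg + g x * df).
Proof. exact: is_deriveM. Qed.

Let dsin f x (df : R) : hasder f x df ->
  hasder (fun t => sin (f t)) x (cos (f x) * df).
Proof. by move=> h; apply: (@is_derive1_comp _ sin f). Qed.

Let dcos f x (df : R) : hasder f x df ->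
  hasder (fun t => cos (f t)) x (- sin (f x) * df).
Proof. by move=> h; apply: (@is_derive1_comp _ cos f). Qed.

Let dE f x (df dg : R) : hasder f x df -> df = dg -> is_derive x 1 f dg.
Proof. by move=> h <-. Qed.

Ltac der := apply: dE;
  [repeat first [apply: dC|apply: dI|apply: dN|apply: dD|apply: dM|apply: dsin|apply: dcos]
  |cbv beta].

Lemma is_derive_continuous F f : (forall x, is_derive x 1 F (f x)) -> continuous F.
Proof.
by move=> dF x; apply/differentiable_continuous/derivable1_diffP; case: (dF x).
Qed.

Lemma FTC2_continuous F f a b : a <= b -> (forall x, is_derive x 1 F (f x)) ->
  continuous f -> (\int[leb]_(x in `[a, b]) (f x)%:E = (F b - F a)%:E)%E.
Proof.
move=> ab dF cf; have cF := is_derive_continuous _ _ dF.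
move: ab; rewrite le_eqVlt => /predU1P[->|ab].
  by rewrite set_itv1 integral_set1 subrr.
rewrite (@continuous_FTC2 _ f F)//; first exact: continuous_subspaceT.
  split.
  - by move=> x _; case: (dF x).
  - exact/cvg_at_right_filter/cF.
  - exact/cvg_at_left_filter/cF.
by move=> x _; rewrite derive1E; exact: derive_val.
Qed.

(** By the mean value theorem. The elementary bounds up to [sin_le_cubic] come from it in a chain,
    each one integrating the one before. *)
Lemma ge0_of_derive F f b : (forall x, is_derive x 1 F (f x)) -> F 0 = 0 ->
  (forall x, 0 <= x <= b -> 0 <= f x) -> forall x, 0 <= x <= b -> 0 <= F x.
Proof.
move=> dF F0 f0 x /andP[x0 xb]; have cF := is_derive_continuous _ _ dF.
have [|c] := @MVT_segment _ F f 0 x x0 (fun y _ => dF y); first exact: continuous_subspaceT.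
rewrite in_itv/= F0 !subr0 => /andP[c0 cx] ->.
by rewrite mulr_ge0// f0// c0 (le_trans cx).
Qed.

Lemma sin_le x : 0 <= x -> sin x <= x.
Proof.
move=> x0; rewrite -subr_ge0.
have dF (y : R) : is_derive y 1 (fun t : R => t - sin t) (1 - cos y) by der; ring.
apply: (ge0_of_derive _ _ x dF).
- by rewrite sin0 subrr.
- by move=> y _; rewrite subr_ge0 cos_le1.
- by rewrite ?x0 ?lexx.
Qed.

Lemma cos_ge x : 1 - x * x / 2 <= cos x.
Proof.
wlog x0 : x / 0 <= x => [ih|].
  have [/ih//|/ltW x0] := leP 0 x; have := ih (- x).
  by rewrite mulrNN cosN oppr_ge0; exact.
rewrite -subr_ge0.
have dF (y : R) : is_derive y 1 (fun t : R => cos t - (1 - t * t / 2)) (y - sin y) by der; field.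
apply: (ge0_of_derive _ _ x dF).
- by rewrite cos0; ring.
- by move=> y /andP[y0 _]; rewrite subr_ge0 sin_le.
- by rewrite ?x0 ?lexx.
Qed.

Lemma sin_ge_half x : 0 <= x <= 1 -> x / 2 <= sin x.
Proof.
move=> x01; rewrite -subr_ge0.
have dF (y : R) : is_derive y 1 (fun t : R => sin t - t / 2) (cos y - 2^-1) by der; ring.
apply: (ge0_of_derive _ _ 1 dF).
- by rewrite sin0; ring.
- by move=> y y01; have := cos_ge y; nra.
- by rewrite ?x0 ?lexx.
Qed.

Lemma cos_le_quad x : `|x| <= 1 -> cos x <= 1 - x * x / 4.
Proof.
wlog x0 : x / 0 <= x => [ih|].
  have [/ih//|/ltW x0] := leP 0 x; have := ih (- x).
  by rewrite mulrNN cosN normrN oppr_ge0; exact.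
rewrite ger0_norm// => x1; rewrite -subr_ge0.
have dF (y : R) : is_derive y 1 (fun t : R => 1 - t * t / 4 - cos t) (sin y - y / 2)
  by der; field.
apply: (ge0_of_derive _ _ 1 dF).
- by rewrite cos0; ring.
- by move=> y y01; rewrite subr_ge0 sin_ge_half.
- by rewrite ?x0 ?lexx.
Qed.

Lemma sin_le_cubic x : 0 <= x <= 1 -> sin x <= x - x * x * x / 12.
Proof.
move=> x01; rewrite -subr_ge0.
have dF (y : R) : is_derive y 1 (fun t : R => t - t * t * t / 12 - sin t)
  (1 - y * y / 4 - cos y) by der; field.
apply: (ge0_of_derive _ _ 1 dF).
- by rewrite sin0; ring.
- by move=> y /andP[y0 y1]; rewrite subr_ge0 cos_le_quad// ger0_norm.
- by rewrite ?x0 ?lexx.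
Qed.

(** On [0, 1] this is the cubic bound, beyond 2 it follows from sin <= 1. In between, x - sin x is
    at least its value at 1, which is at least 1/12 >= x/24; this range fixes the constant 24. *)
Lemma sub_sin_ge x : 0 <= x -> x * Num.min 1 (x * x) / 24 <= x - sin x.
Proof.
move=> x0; have [x1|x1] := leP x 1.
  have := @sin_le_cubic x; rewrite x0 x1 => /(_ isT) h.
  have h2 : Num.min 1 (x * x) <= x * x by rewrite ge_min lexx orbT.
  have h3 : 0 <= x * (x * x) by rewrite !mulr_ge0.
  by have := ler_wpM2l x0 h2; lra.
have h1 : x * Num.min 1 (x * x) <= x.
  by rewrite -[leRHS]mulr1 ler_wpM2l// ge_min lexx.
have [x2|x2] := leP x 2; last by have := sin_le1 x; lra.
suff : 1 - sin 1 <= x - sin x by have := @sin_le_cubic 1; rewrite ler01 lexx => /(_ isT); lra.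
have dF (y : R) : is_derive y 1 (fun t : R => t - sin t) (1 - cos y) by der; ring.
have cF := is_derive_continuous _ _ dF.
have [|c _] := MVT_segment (ltW x1) (fun y _ => dF y); first exact: continuous_subspaceT.
 have : 0 <= (1 - cos c) * (x - 1) by rewrite mulr_ge0 ?subr_ge0 ?cos_le1 ?ltW.
by lra.
Qed.

Lemma integral_one_sub_cos b u : b != 0 -> 0 <= u ->
  (\int[leb]_(s in `[(- u)%R, u]) (1 - cos (b * s))%:E
   = (2 * (u - sin (b * u) / b))%:E)%E.
Proof.
move=> b0 u0.
have dF (y : R) : is_derive y 1 (fun t : R => t - sin (b * t) / b) (1 - cos (b * y)).
  by der; field.
have df (y : R) : is_derive y 1 (fun t : R => 1 - cos (b * t)) (b * sin (b * y)).
  by der; ring.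
rewrite (FTC2_continuous _ _ _ _ _ dF); [|by lra|exact: is_derive_continuous df].
by congr EFin; rewrite mulrN sinN; ring.
Qed.

Lemma integral_sqr u : 0 <= u ->
  (\int[leb]_(s in `[(- u)%R, u]) (s ^+ 2)%:E = (2 / 3 * u ^+ 3)%:E)%E.
Proof.
move=> u0.
have dF (y : R) : is_derive y 1 (fun t : R => t * t * t / 3) (y ^+ 2) by der; field.
rewrite (FTC2_continuous _ _ _ _ _ dF); [|by lra|exact: exprn_continuous].
by congr EFin; field.
Qed.

Definition tri x : R := Num.max 0 (1 - `|x|).

(** The Fourier transform of [tri], equal to (sin(s/2)/(s/2))^2, with its continuous value at 0. *)
Definition sinc2 s : R := if s == 0 then 1 else 2 * (1 - cos s) / (s * s).

Lemma tri_ge0 x : 0 <= tri x.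
Proof. by rewrite /tri le_max lexx. Qed.

Lemma tri_le1 x : tri x <= 1.
Proof. by rewrite /tri ge_max ler01/= lerBlDr lerDl. Qed.

Lemma tri_eq0 x : 1 <= `|x| -> tri x = 0.
Proof. by move=> x1; rewrite /tri; apply/max_idPl; rewrite subr_le0. Qed.

Lemma measurable_tri : measurable_fun setT tri.
Proof.
by apply: measurable_maxr => //; apply: measurable_funB.
Qed.

Lemma sinc2_ge0 s : 0 <= sinc2 s.
Proof.
rewrite /sinc2; case: ifPn => // _.
by apply: divr_ge0; rewrite -?expr2 ?sqr_ge0// mulr_ge0// subr_ge0 cos_le1.
Qed.

Lemma sinc2_le1 s : sinc2 s <= 1.
Proof.
rewrite /sinc2; case: ifPn => // s0.
rewrite ler_pdivrMr; last by rewrite -expr2 exprn_even_gt0.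
by have := cos_ge s; lra.
Qed.

(** From 1 - cos 2s = 2 (1 - cos s)(1 + cos s). Doubling the argument thus never increases [sinc2],
    and the loss is sinc2 s (1 - cos s)/2. *)
Lemma sinc2_double s : sinc2 (2 * s) = sinc2 s * ((1 + cos s) / 2).
Proof.
rewrite /sinc2 mulf_eq0 pnatr_eq0/=; have [->|s0] := eqVneq s 0.
  by rewrite cos0; field.
by rewrite (_ : 2 * s = s *+ 2) ?cos_mulr2n ?mulr_natl// -mulr_natl; field.
Qed.

Let integral_tri_split f : continuous f -> (forall x, 0 <= f x) ->
  (\int[leb]_x (tri x * f x)%:E = \int[leb]_(x in `[(-1)%R, 0%R]) ((1 + x) * f x)%:E
    + \int[leb]_(x in `[0%R, 1%R]) ((1 - x) * f x)%:E)%E.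
Proof.
move=> cf f0.
have mf : measurable_fun setT f by exact: continuous_measurable_fun.
have mtf : measurable_fun setT (fun x => (tri x * f x)%:E).
  by apply/measurable_EFinP; apply: measurable_funM => //; exact: measurable_tri.
transitivity (\int[leb]_(x in `[(-1)%R, 1%R]) (tri x * f x)%:E)%E.
  rewrite [RHS]integral_mkcond; apply: eq_integral => x _; rewrite patchE.
  case: ifPn => // /negP; rewrite inE/= in_itv/= -ler_norml => /negP.
  by rewrite -ltNge => /ltW /tri_eq0 ->; rewrite mul0r.
have -> : `[-1, 1]%classic = `[-1, 0]%classic `|` `]0, 1]%classic :> set (measurableTypeR R).
  apply/seteqP; split => x /=; rewrite !in_itv/=.
    by move=> /andP[h1 h2]; have [x0|x0] := leP x 0; [left|right]; lra.
  by case=> /andP[h1 h2]; lra.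
rewrite ge0_integral_setU//=; last 3 first.
- exact: measurable_funTS.
- by move=> x _; rewrite lee_fin mulr_ge0// tri_ge0.
- rewrite disj_set2E; apply/eqP/seteqP; split => x //=; rewrite !in_itv/=.
  by case=> /andP[_ x0] /andP[]; rewrite ltNge x0.
rewrite integral_itv_obnd_cbnd; last exact: measurable_funTS.
congr (_ + _)%E; apply: eq_integral => x; rewrite inE/= in_itv/= => /andP[h1 h2].
  by rewrite /tri ler0_norm// opprK; congr ((_ * _)%:E); apply/max_idPr; lra.
by rewrite /tri ger0_norm//; congr ((_ * _)%:E); apply/max_idPr; lra.
Qed.

(** The amplitude [be], at most 1 in absolute value, keeps the integrand nonnegative; together with
    the phase [al] it makes the formula stable under integrating out one coordinate after
    another. *)
Lemma integral_tri_cos be al s : `|be| <= 1 ->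
  (\int[leb]_x (tri x * (1 + be * cos (al + s * x)))%:E
   = (1 + be * cos al * sinc2 s)%:E)%E.
Proof.
move=> be1.
have f0 x : 0 <= 1 + be * cos (al + s * x).
  have : `|be * cos (al + s * x)| <= 1.
    by rewrite normrM mulr_ile1// cos_max.
  by rewrite ler_norml => /andP[]; lra.
have df (y : R) : is_derive y 1 (fun t : R => 1 + be * cos (al + s * t))
    (- be * s * sin (al + s * y)) by der; ring.
have cf := is_derive_continuous _ _ df.
rewrite integral_tri_split//.
have c1 : continuous (fun x => (1 + x) * (1 + be * cos (al + s * x))).
  apply: (is_derive_continuous _ (fun x => (1 + be * cos (al + s * x))
    + (1 + x) * (- be * s * sin (al + s * x)))) => y.
  by der; ring.
have c2 : continuous (fun x => (1 - x) * (1 + be * cos (al + s * x))).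
  apply: (is_derive_continuous _ (fun x => - (1 + be * cos (al + s * x))
    + (1 - x) * (- be * s * sin (al + s * x)))) => y.
  by der; ring.
rewrite /sinc2; have [s0|s0] := eqVneq s 0.
  have d1 (y : R) : is_derive y 1
      (fun t : R => (t + t * t / 2) * (1 + be * cos al))
      ((1 + y) * (1 + be * cos (al + s * y))).
    by der; rewrite s0 mul0r addr0; field.
  have d2 (y : R) : is_derive y 1
      (fun t : R => (t - t * t / 2) * (1 + be * cos al))
      ((1 - y) * (1 + be * cos (al + s * y))).
    by der; rewrite s0 mul0r addr0; field.
  rewrite (FTC2_continuous _ _ _ _ _ d1) ?lerN10//.
  rewrite (FTC2_continuous _ _ _ _ _ d2)//.
  by rewrite -EFinD; congr EFin; field.
(* Antiderivatives obtained by integration by parts; they divide by s, hence the separate case s =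
   0. *)
have d1 (y : R) : is_derive y 1
    (fun t : R => t + t * t / 2 + be * ((1 + t) * sin (al + s * t) / s
       + cos (al + s * t) / (s * s)))
    ((1 + y) * (1 + be * cos (al + s * y))).
  by der; field.
have d2 (y : R) : is_derive y 1
    (fun t : R => t - t * t / 2 + be * ((1 - t) * sin (al + s * t) / s
       - cos (al + s * t) / (s * s)))
    ((1 - y) * (1 + be * cos (al + s * y))).
  by der; field.
rewrite (FTC2_continuous _ _ _ _ _ d1) ?lerN10//.
rewrite (FTC2_continuous _ _ _ _ _ d2)//.
rewrite -EFinD; congr EFin.
have -> : al + s * -1 = al - s by ring.
have -> : al + s * 1 = al + s by ring.
have -> : al + s * 0 = al by ring.
by rewrite cosB cosD; field.
Qed.

End calculus.

(** * Product kernels, their Fourier transform and the gap under doubling *)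

Section kernel.
Context {R : realType}.
Local Notation leb := (@lebesgue_measure R).

Fixpoint scaled (n : nat) (a : R) : Rd R n -> Rd R n :=
  match n return Rd R n -> Rd R n with
  | 0 => fun x => a * x
  | S m => fun x => (a * x.1, scaled m a x.2) end.

Fixpoint trid (n : nat) : Rd R n -> R :=
  match n return Rd R n -> R with
  | 0 => fun x => tri x
  | S m => fun x => tri x.1 * trid m x.2 end.

Fixpoint sinc2d (n : nat) : Rd R n -> R :=
  match n return Rd R n -> R with
  | 0 => fun x => sinc2 x
  | S m => fun x => sinc2 x.1 * sinc2d m x.2 end.

Fixpoint boxd (n : nat) (a b : R) : set (Rd R n) :=
  match n return set (Rd R n) with
  | 0 => `[a, b]%classic
  | S m => `[a, b]%classic `*` boxd m a b end.

Lemma dotd_scaledl n a (x y : Rd R n) : dotd (scaled n a x) y = a * dotd x y.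
Proof. by elim: n x y => [|n ih] x y /=; rewrite ?ih; ring. Qed.

Lemma dotd_scaledr n a (x y : Rd R n) : dotd x (scaled n a y) = a * dotd x y.
Proof. by elim: n x y => [|n ih] x y /=; rewrite ?ih; ring. Qed.

Lemma scaled_scaled n a b (x : Rd R n) : scaled n a (scaled n b x) = scaled n (a * b) x.
Proof. by elim: n x => [|n ih] x /=; rewrite ?ih mulrA. Qed.

Lemma measurable_scaled n a : measurable_fun setT (scaled n a).
Proof.
elim: n => [|n ih] /=; first exact: measurable_funM.
apply/measurable_fun_pairP; split.
  by apply: measurable_funM => //; exact: measurable_fst.
exact: (measurableT_comp ih measurable_snd).
Qed.

Lemma trid_ge0 n (x : Rd R n) : 0 <= trid n x.
Proof. by elim: n x => [|n ih] x /=; rewrite ?mulr_ge0 ?tri_ge0. Qed.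

Lemma trid_le1 n (x : Rd R n) : trid n x <= 1.
Proof.
elim: n x => [|n ih] x /=; first exact: tri_le1.
by rewrite mulr_ile1 ?tri_ge0 ?trid_ge0 ?tri_le1.
Qed.

Lemma trid_support n (x : Rd R n) : trid n x != 0 -> dotd x x <= n.+1%:R.
Proof.
have tri1 (s : R) : tri s != 0 -> s * s <= 1.
  move=> s0; have /ltW : `|s| < 1.
    by rewrite ltNge; apply: contra s0 => /tri_eq0 ->.
  rewrite -expr2 -[s ^+ 2]real_normK ?num_real// => s1.
  by rewrite exprn_ile1.
elim: n x => [|n ih] x /=; first exact: tri1.
rewrite mulf_eq0 negb_or => /andP[/tri1 h1 /ih h2].
by rewrite -[n.+2]add1n natrD; apply: lerD.
Qed.

Lemma measurable_trid n : measurable_fun setT (trid n).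
Proof.
elim: n => [|n ih] /=; first exact: measurable_tri.
by apply: measurable_funM; [exact: (measurableT_comp measurable_tri measurable_fst)
  |exact: (measurableT_comp ih measurable_snd)].
Qed.

Lemma sinc2d_ge0 n (x : Rd R n) : 0 <= sinc2d n x.
Proof. by elim: n x => [|n ih] x /=; rewrite ?mulr_ge0 ?sinc2_ge0. Qed.

Lemma sinc2d_le1 n (x : Rd R n) : sinc2d n x <= 1.
Proof.
elim: n x => [|n ih] x /=; first exact: sinc2_le1.
by rewrite mulr_ile1 ?sinc2_ge0 ?sinc2d_ge0 ?sinc2_le1.
Qed.

(** Induction on the dimension: the tail is integrated with phase al + y.1 s, which leaves a
    one-dimensional integral of the same shape with amplitude [be * sinc2d n y.2]. *)
Lemma integral_trid_cos n (be al : R) (y : Rd R n) : `|be| <= 1 ->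
  (\int[lebd R n]_x (trid n x * (1 + be * cos (al + dotd x y)))%:E
   = (1 + be * cos al * sinc2d n y)%:E)%E.
Proof.
have cge0 (b t : R) : `|b| <= 1 -> 0 <= 1 + b * cos t.
  move=> b1; have : `|b * cos t| <= 1 by rewrite normrM mulr_ile1// cos_max.
  by rewrite ler_norml => /andP[]; lra.
elim: n be al y => [|n ih] be al y be1.
  by rewrite -integral_tri_cos//; apply: eq_integral => x _ /=; rewrite [x * y]mulrC.
have mF m (z : Rd R m) (b a : R) :
    measurable_fun setT (fun x : Rd R m => (trid m x * (1 + b * cos (a + dotd x z)))%:E).
  apply/measurable_EFinP; apply: measurable_funM; first exact: measurable_trid.
  apply: measurable_funD => //; apply: measurable_funM => //.
  apply: (measurableT_comp (f := cos)).
    by apply: continuous_measurable_fun; exact: continuous_cos.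
  by apply: measurable_funD => //; exact: measurable_dotd.
rewrite integral_lebdS; [|exact: mF|]; last first.
  by move=> x; rewrite lee_fin mulr_ge0 ?trid_ge0 ?cge0.
have be'1 : `|be * sinc2d n y.2| <= 1.
  by rewrite normrM mulr_ile1// ger0_norm ?sinc2d_ge0 ?sinc2d_le1.
transitivity (1 + (be * sinc2d n y.2) * cos al * sinc2 y.1)%:E; last first.
  by congr EFin => /=; ring.
rewrite -integral_tri_cos//; apply: eq_integral => s _.
transitivity (\int[lebd R n]_z ((tri s)%:E *
  (trid n z * (1 + be * cos ((al + y.1 * s) + dotd z y.2)))%:E))%E.
  apply: eq_integral => z _ /=; rewrite -EFinM; congr EFin.
  rewrite mulrA; congr (_ * (1 + be * cos _)); ring.
rewrite ge0_integralZl//=.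
- by rewrite ih// -EFinM; congr EFin; ring.
- by move=> z _; rewrite lee_fin mulr_ge0 ?trid_ge0 ?cge0.
- by rewrite lee_fin tri_ge0.
Qed.

Lemma sinc2d_double_le n (y : Rd R n) : sinc2d n (scaled n 2 y) <= sinc2d n y.
Proof.
have h (s : R) : sinc2 (2 * s) <= sinc2 s.
  rewrite sinc2_double -[leRHS]mulr1 ler_wpM2l ?sinc2_ge0//.
  by have := cos_le1 s; lra.
elim: n y => [|n ih] y /=; first exact: h.
by apply: ler_pM; rewrite ?sinc2_ge0 ?sinc2d_ge0.
Qed.

(** On the box 1 - cos s >= s^2/4, so each [sinc2] factor is at least 1/2. The last coordinate
    supplies the gap, at least (1/2)(a^2/8), and each of the other n coordinates costs a factor
    1/2. *)
Lemma sinc2d_double_gap n (a b : R) (y : Rd R n) : 0 < a -> b <= 1 -> boxd n a b y ->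
  a * a / 16 / 2 ^+ n <= sinc2d n y - sinc2d n (scaled n 2 y).
Proof.
move=> a0 b1.
have cosl (s : R) : a <= s <= b -> s * s / 4 <= 1 - cos s.
  move=> /andP[h1 h2]; have := @cos_le_quad _ s; rewrite ger0_norm; last by lra.
  by move=> /(_ (le_trans h2 b1)); lra.
have half (s : R) : a <= s <= b -> 2^-1 <= sinc2 s.
  move=> hs; have /andP[h1 h2] := hs.
  have s0 : 0 < s by lra.
  rewrite /sinc2 gt_eqF// ler_pdivlMr ?mulr_gt0//.
  by have := cosl _ hs; lra.
elim: n y => [|n ih] y /=.
  rewrite in_itv/= => hy; have /andP[h1 h2] := hy.
  rewrite expr0 divr1 sinc2_double.
  have -> : sinc2 y - sinc2 y * ((1 + cos y) / 2) = sinc2 y * ((1 - cos y) / 2).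
    by field.
  have aay : a * a <= y * y by apply: ler_pM => //; exact: ltW.
  apply: le_trans (_ : 2^-1 * (a * a / 4 / 2) <= _); first by lra.
  apply: ler_pM => //; first exact: mulr_ge0 (mulr_ge0 (mulr_ge0 (ltW a0) (ltW a0)) _) _.
    exact: half.
  by have := cosl _ hy; lra.
rewrite in_itv/= => -[hy /ih {}ih].
have h1 := half _ hy.
have h2 : sinc2 (2 * y.1) <= sinc2 y.1.
  rewrite sinc2_double -[leRHS]mulr1 ler_wpM2l ?sinc2_ge0//.
  by have := cos_le1 y.1; lra.
(* The doubled first factor is replaced by the larger undoubled one, which can then be factored
   out. *)
apply: le_trans (_ : sinc2 y.1 * (sinc2d n y.2 - sinc2d n (scaled n 2 y.2)) <= _).
  rewrite exprS invfM mulrCA; apply: ler_pM => //.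
  by rewrite !mulr_ge0 ?invr_ge0 ?exprn_ge0// ltW.
by rewrite mulrBr lerD2l lerN2 ler_wpM2r// sinc2d_ge0.
Qed.

Lemma measurable_boxd n a b : measurable (boxd n a b).
Proof.
elim: n => [|n ih] /=; first exact: measurable_itv.
by apply: measurableX => //; exact: measurable_itv.
Qed.

Lemma lebd_boxd n a b : a <= b -> lebd R n (boxd n a b) = ((b - a) ^+ n.+1)%:E.
Proof.
move=> ab; have lab : leb `[a, b]%classic = (b - a)%:E.
  rewrite lebesgue_measure_itv/= lte_fin; case: ltgtP ab => // -> _.
  by rewrite subrr.
elim: n => [|n ih]; first by rewrite expr1 -lab.
rewrite lebdS_setX//; last exact: measurable_boxd.
by rewrite ih lab -EFinM -exprS.
Qed.

Lemma boxd_normd n a b (y : Rd R n) : 0 < a -> boxd n a b y ->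
  0 < dotd y y <= n.+1%:R * (b * b).
Proof.
move=> a0; elim: n y => [|n ih] y /=; rewrite in_itv/=.
  move=> /andP[h1 h2]; have y0 := lt_le_trans a0 h1.
  by rewrite mulr_gt0//= mul1r ler_pM// ltW.
move=> [/andP[h1 h2] /ih/andP[h3 h4]]; have y0 := lt_le_trans a0 h1.
rewrite addr_gt0 ?mulr_gt0//= -[n.+2]add1n natrD mulrDl mul1r lerD//.
by rewrite ler_pM// ltW.
Qed.

End kernel.

(** * Coordinate directions and subadditivity of the truncation at 1 *)

Section unit_vectors.
Context {R : realType}.

(** Coordinate vectors; an index past the dimension gives the last one, so every value has norm
    1. *)
Fixpoint unitd (m i : nat) : Rd R m :=
  match m return Rd R m with
  | 0 => (1 : R)
  | S m' => if i is j.+1 then ((0 : R), unitd m' j) else ((1 : R), zerod R m')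
  end.

Lemma dotd_zerod m (y : Rd R m) : dotd (zerod R m) y = 0.
Proof. by elim: m y => [|m ih] y /=; rewrite ?ih mul0r ?addr0. Qed.

Lemma normd_unitd m i : normd (unitd m i) = 1.
Proof.
suff h : dotd (unitd m i) (unitd m i) = 1 by rewrite /normd h sqrtr1.
elim: m i => [|m ih] [|i] /=; rewrite ?mulr1// ?dotd_zerod ?addr0//.
by rewrite mul0r add0r.
Qed.

Lemma sum_unitd m (y : Rd R m) : \sum_(i < m.+1) dotd (unitd m i) y ^+ 2 = dotd y y.
Proof.
elim: m y => [|m ih] y; first by rewrite big_ord1 /= mul1r expr2.
rewrite big_ord_recl /= mul1r dotd_zerod addr0 expr2; congr (_ + _).
by rewrite -ih; apply: eq_bigr => i _ /=; rewrite mul0r add0r.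
Qed.

Lemma min1_sum (I : Type) (s : seq I) (a : I -> R) : (forall i, 0 <= a i) ->
  Num.min 1 (\sum_(i <- s) a i) <= \sum_(i <- s) Num.min 1 (a i).
Proof.
move=> a0; elim: s => [|i s ih]; first by rewrite !big_nil ge_min lexx orbT.
rewrite !big_cons; apply: le_trans (lerD (lexx _) ih).
have s0 : 0 <= \sum_(j <- s) a j by apply: sumr_ge0.
have := a0 i; rewrite /Num.min; do 3 case: ifPn; rewrite -?leNgt; lra.
Qed.

End unit_vectors.

(** * The exponent, h and K_1 of a unimodal density *)

Section levy_density.
Context {R : realType} {n : nat}.
Variable nu : Rd R n.+1 -> R.
Hypothesis nuP : iso_unimodal_levy_density nu.
Local Notation leb := (@lebesgue_measure R).
Local Notation lam := (lebd R n.+1).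

Let mnu : measurable_fun setT nu. Proof. by case: nuP. Qed.
Let nu0 y : 0 <= nu y. Proof. by case: nuP. Qed.
Let nu_rad x y : normd x = normd y -> nu x = nu y.
Proof. by case: nuP => _ _ h _ _; exact: h. Qed.
Let nu_dec x y : 0 < normd x -> normd x <= normd y -> nu y <= nu x.
Proof. by case: nuP => _ _ _ h _; exact: h. Qed.

Let mfnu (f : Rd R n.+1 -> R) : measurable_fun setT f ->
  measurable_fun setT (fun y => (f y * nu y)%:E).
Proof. by move=> mf; apply/measurable_EFinP; exact: measurable_funM. Qed.

Let mfnu1 (F : R -> R) : measurable_fun setT F ->
  measurable_fun setT (fun y : Rd R n.+1 => (F y.1 * nu y)%:E).
Proof.
move=> mF; apply: (mfnu (fun y => F y.1)).
exact: (measurableT_comp mF measurable_fst).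
Qed.

Let fnu0 (f : Rd R n.+1 -> R) : (forall y, 0 <= f y) ->
  forall y, (0 <= (f y * nu y)%:E)%E.
Proof. by move=> f0 y; rewrite lee_fin mulr_ge0. Qed.

(** A rotation of [xi] to the first axis preserves norms, hence the radial [nu]. Evenness of [F]
    absorbs the sign of [eta], which is known only through its square. *)
Lemma integral_nu_rotation (xi : Rd R n.+1) (F : R -> R) :
  measurable_fun setT F -> (forall s, 0 <= F s) -> (forall s, F (- s) = F s) ->
  (\int[lam]_y (F (dotd xi y) * nu y)%:E
   = \int[lam]_y (F (normd xi * y.1) * nu y)%:E)%E.
Proof.
move=> mF F0 Feven; have [T [eta [[mT pT] nT dT eE]]] := rotation_to_axis _ xi.
rewrite -(pT (fun y => (F (dotd xi y) * nu y)%:E)).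
- apply: eq_integral => y _; congr ((_ * _)%:E); last first.
    by apply: nu_rad; rewrite /normd nT.
  rewrite dT -[hd _ _]/(y.1).
  have : eta ^+ 2 == normd xi ^+ 2 by rewrite sqr_normd eE.
  by rewrite eqf_sqr => /orP[/eqP ->//|/eqP ->]; rewrite mulNr Feven.
- apply: (mfnu (fun y => F (dotd xi y))); apply: (measurableT_comp mF).
  exact: measurable_dotd.
- by apply: (fnu0 (fun y => F (dotd xi y))).
Qed.

Let mcosb (b : R) : measurable_fun setT (fun s : R => 1 - cos (b * s)).
Proof.
apply: measurable_funB => //; apply: (measurableT_comp (f := cos)).
  by apply: continuous_measurable_fun; exact: continuous_cos.
exact: measurable_funM.
Qed.

Let cosb0 (b s : R) : 0 <= 1 - cos (b * s).
Proof. by rewrite subr_ge0 cos_le1. Qed.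

Lemma psi_axis (xi : Rd R n.+1) :
  (psi nu xi = \int[lam]_y ((1 - cos (normd xi * y.1)) * nu y)%:E)%E.
Proof.
have h := integral_nu_rotation xi (fun s => 1 - cos s); apply: h.
- by have := mcosb 1; under eq_fun do rewrite mul1r.
- by move=> s; rewrite subr_ge0 cos_le1.
- by move=> s; rewrite cosN.
Qed.

(** Gives finiteness of the integrals behind [psi], [hfun] and, by comparison with [hfun], [K1] at
    positive radii, so that [fine] does not return its default value on them. *)
Lemma integral_nu_lty (c : R) (f : Rd R n.+1 -> R) : measurable_fun setT f ->
  (forall y, 0 <= f y <= c * Num.min 1 (normd y ^+ 2)) ->
  (\int[lam]_y (f y * nu y)%:E < +oo)%E.
Proof.
move=> mf fc; have [_ _ _ _ fin] := nuP.
have m0 (y : Rd R n.+1) : 0 <= Num.min 1 (normd y ^+ 2).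
  by rewrite le_min ler01 sqr_ge0.
have mm : measurable_fun setT (fun y : Rd R n.+1 => Num.min 1 (normd y ^+ 2)).
  apply: measurable_minr => //; apply: measurable_funX; exact: measurable_normd.
apply: (@le_lt_trans _ _ (\int[lam]_y (`|c|%:E * (Num.min 1 (normd y ^+ 2) * nu y)%:E))%E).
  apply: ge0_le_integral => //.
  - by move=> y _; apply: fnu0 => z; have /andP[] := fc z.
  - exact: mfnu.
  - by apply: emeasurable_funM => //; exact: (mfnu (fun y => Num.min 1 (normd y ^+ 2))).
  - move=> y _; rewrite -EFinM lee_fin mulrA ler_wpM2r//.
    have /andP[_ h] := fc y; apply: le_trans h _.
    by rewrite ler_wpM2r// ler_norm.
rewrite ge0_integralZl//; last 2 first.
- exact: (mfnu (fun y => Num.min 1 (normd y ^+ 2))).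
- by move=> y _; exact: (fnu0 (fun y => Num.min 1 (normd y ^+ 2))).
by rewrite lte_mul_pinfty ?lee_fin.
Qed.

Lemma psi_fin (xi : Rd R n.+1) : psi nu xi \is a fin_num.
Proof.
rewrite psi_axis ge0_fin_numE; last first.
  by apply: integral_ge0 => y _; rewrite lee_fin mulr_ge0.
apply: (integral_nu_lty (2 + normd xi ^+ 2)) => [|y].
  exact: (measurableT_comp (mcosb (normd xi)) measurable_fst).
rewrite cosb0/=.
have h1 := cos_ge (normd xi * y.1); have h2 := cos_geN1 (normd xi * y.1).
have h3 : y.1 ^+ 2 <= normd y ^+ 2 by rewrite sqr_normd; exact: (sqr_hd_le n.+1 y).
have h4 : 0 <= normd xi ^+ 2 by exact: sqr_ge0.
rewrite minr_pMr; last by lra.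
rewrite le_min; apply/andP; split; first by lra.
have h5 := ler_wpM2l h4 h3.
have h6 : 0 <= normd y ^+ 2 by exact: sqr_ge0.
have -> : (2 + normd xi ^+ 2) * normd y ^+ 2
          = 2 * normd y ^+ 2 + normd xi ^+ 2 * normd y ^+ 2 by ring.
have : normd xi * y.1 * (normd xi * y.1) = normd xi ^+ 2 * y.1 ^+ 2 by ring.
by move: h1 h5 h6 (mulr_ge0 h4 h6); lra.
Qed.

Lemma hfunE (r : R) : 0 < r -> (hfun nu r)%:E =
  (\int[lam]_y (Num.min 1 (r ^- 2 * normd y ^+ 2) * nu y)%:E)%E.
Proof.
move=> r0; rewrite /hfun fineK// ge0_fin_numE; last first.
  apply: integral_ge0 => y _; rewrite lee_fin mulr_ge0// le_min ler01.
  by rewrite mulr_ge0 ?sqr_ge0// invr_ge0 exprn_ge0// ltW.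
have i0 : 0 <= r ^- 2 by rewrite invr_ge0 exprn_ge0// ltW.
apply: (integral_nu_lty (1 + r ^- 2)) => [|y].
  apply: measurable_minr => //; apply: measurable_funM => //.
  by apply: measurable_funX; exact: measurable_normd.
have y0 : 0 <= normd y ^+ 2 by exact: sqr_ge0.
rewrite le_min ler01 mulr_ge0//= minr_pMr; last by lra.
rewrite le_min !ge_min; apply/andP; split; apply/orP; first by left; lra.
by right; rewrite mulrDl mul1r lerDr.
Qed.

(** The kernel of K_1 as a weight of the first coordinate. By [K1E], K_1(r) is its integral against
    [nu], the form in which [majorization_lebd] compares it with 1 - cos. *)
Definition kap (r s : R) : R := if (- r <= s <= r) then r ^- 2 * s ^+ 2 else 0.

Lemma kap_ge0 r s : 0 <= kap r s.
Proof.
by rewrite /kap; case: ifP => // _; rewrite mulr_ge0 ?invr_ge0 ?sqr_ge0.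
Qed.

Lemma measurable_kap r : measurable_fun setT (kap r).
Proof.
apply: measurable_fun_ifT => //; first by apply: measurable_and; exact: measurable_fun_ler.
by apply: measurable_funM => //; exact: measurable_funX.
Qed.

Lemma kap_le r (y : Rd R n.+1) : 0 < r ->
  kap r y.1 <= Num.min 1 (r ^- 2 * normd y ^+ 2).
Proof.
move=> r0; have r20 : 0 < r ^+ 2 by rewrite exprn_gt0.
have i0 : 0 <= r ^- 2 by rewrite invr_ge0 ltW.
rewrite /kap; case: ifP => [h|_]; last by rewrite le_min ler01 mulr_ge0// sqr_ge0.
rewrite le_min; apply/andP; split.
  rewrite mulrC ler_pdivrMr// mul1r -[leLHS]real_normK ?num_real//.
  by rewrite lerXn2r ?nnegrE ?(ltW r0)// ler_norml.
by rewrite ler_wpM2l// sqr_normd; exact: (sqr_hd_le n.+1 y).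
Qed.

Lemma K1E (r : R) : 0 < r ->
  (K1 nu r)%:E = (\int[lam]_y (kap r y.1 * nu y)%:E)%E.
Proof.
move=> r0; have i0 : 0 <= r ^- 2 by rewrite invr_ge0 exprn_ge0// ltW.
have E : ((r ^- 2)%:E * \int[leb]_(s in [set s : R | (- r <= s <= r)%R])
           ((s ^+ 2)%:E * nu1 nu s) = \int[lam]_y (kap r y.1 * nu y)%:E)%E.
  have mnu1 : measurable_fun setT (fun s : measurableTypeR R => nu1 nu s).
    apply: (measurable_fun_fubini_tonelli_F (m2 := lebd R n)
      (fun y : Rd R n.+1 => (nu y)%:E)) => //.
    exact/measurable_EFinP.
  have nu10 s : (0 <= nu1 nu s)%E by apply: integral_ge0 => z _; rewrite lee_fin.
  rewrite integral_lebdS; [|exact: mfnu1 (measurable_kap r)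
    |by apply: (fnu0 (fun y => kap r y.1)) => y; exact: kap_ge0].
  rewrite integral_mkcond -ge0_integralZl//=.
  - apply: eq_integral => s _; rewrite patchE.
    transitivity ((kap r s)%:E * nu1 nu s)%E.
      rewrite /kap; case: ifPn => [/set_mem/= ->|/negP ns].
        by rewrite EFinM muleA.
      rewrite ifF ?mule0 ?mul0e//; apply/negP => h; apply: ns; exact: mem_set.
    rewrite -ge0_integralZl//=.
    + apply/measurable_EFinP; exact: (measurableT_comp mnu (pair1_measurable s)).
    + by move=> z _; rewrite lee_fin.
    + by rewrite lee_fin kap_ge0.
  - have mD : measurable [set s : measurableTypeR R | (- r <= s <= r)%R].
      apply: (@measurable_set_bool _ (measurableTypeR R) (fun s => (- r <= s) && (s <= r))).
      by apply: measurable_and; exact: measurable_fun_ler.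
    apply/(measurable_restrictT _ mD).
    apply: emeasurable_funM; last exact: measurable_funTS.
    apply/measurable_EFinP; apply: measurable_funX; exact: measurable_id.
  - move=> s _; apply: erestrict_ge0 => t _; apply: mule_ge0 => //.
    by rewrite lee_fin sqr_ge0.
    exact: nu10.
rewrite /K1 E fineK// ge0_fin_numE; last first.
  by apply: integral_ge0 => y _; apply: (fnu0 (fun y => kap r y.1)) => z; exact: kap_ge0.
apply: (@le_lt_trans _ _ (hfun nu r)%:E); last exact: ltry.
rewrite hfunE//; apply: ge0_le_integral => //.
- by move=> y _; apply: (fnu0 (fun y => kap r y.1)) => z; exact: kap_ge0.
- exact: mfnu1 (measurable_kap r).
- apply: (mfnu (fun y => Num.min 1 (r ^- 2 * normd y ^+ 2))).
  apply: measurable_minr => //; apply: measurable_funM => //.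
  by apply: measurable_funX; exact: measurable_normd.
- by move=> y _; rewrite lee_fin ler_wpM2r// kap_le.
Qed.

Lemma K1_ge0 r : 0 < r -> 0 <= K1 nu r.
Proof.
move=> r0; rewrite -lee_fin K1E//; apply: integral_ge0 => y _.
by apply: (fnu0 (fun y => kap r y.1)) => z; exact: kap_ge0.
Qed.

Lemma K1_le_hfun r : 0 < r -> K1 nu r <= hfun nu r.
Proof.
move=> r0; rewrite -lee_fin K1E// hfunE//; apply: ge0_le_integral => //.
- by move=> y _; apply: (fnu0 (fun y => kap r y.1)) => z; exact: kap_ge0.
- exact: mfnu1 (measurable_kap r).
- apply: (mfnu (fun y => Num.min 1 (r ^- 2 * normd y ^+ 2))).
  apply: measurable_minr => //; apply: measurable_funM => //.
  by apply: measurable_funX; exact: measurable_normd.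
- by move=> y _; rewrite lee_fin ler_wpM2r// kap_le.
Qed.

Lemma normd_scaled m (a : R) (x : Rd R m) : 0 <= a -> normd (scaled m a x) = a * normd x.
Proof.
move=> a0; rewrite /normd dotd_scaledl dotd_scaledr mulrA sqrtrM; last first.
  by rewrite mulr_ge0.
by rewrite -expr2 sqrtr_sqr ger0_norm.
Qed.

Let integral_kap_ge (r u : R) : 0 < r -> 0 <= u ->
  ((2 / 3 * (r ^- 2 * Num.min u r ^+ 3))%:E <=
   \int[leb]_(s in `[(- u)%R, u]) (kap r s)%:E)%E.
Proof.
move=> r0 u0; set v := Num.min u r.
have v0 : 0 <= v by rewrite le_min u0 ltW.
have vu : v <= u by rewrite ge_min lexx.
have vr : v <= r by rewrite ge_min lexx orbT.
have i0 : 0 <= r ^- 2 by rewrite invr_ge0 exprn_ge0// ltW.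
apply: (@le_trans _ _ (\int[leb]_(s in `[(- v)%R, v]) (kap r s)%:E)%E); last first.
  apply: ge0_subset_integral => //.
  - apply/measurable_EFinP; apply: measurable_funTS; exact: measurable_kap.
  - by move=> s _; rewrite lee_fin kap_ge0.
  - by move=> s /=; rewrite !in_itv/= => /andP[h1 h2]; apply/andP; split; lra.
rewrite (eq_integral (fun s : measurableTypeR R => (r ^- 2)%:E * (s ^+ 2)%:E)%E); last first.
  move=> s; rewrite inE/= in_itv/= => /andP[h1 h2]; rewrite -EFinM; congr EFin.
  by rewrite /kap ifT//; apply/andP; split; lra.
rewrite ge0_integralZl//=.
- by rewrite integral_sqr// -EFinM lee_fin; lra.
- by apply/measurable_EFinP; apply: measurable_funTS; exact: measurable_funX.
- by move=> s _; rewrite lee_fin sqr_ge0.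
Qed.

Let sin_one_sub_cos_le (x : R) : 0 <= x -> sin x * (1 - cos x) <= x * (x * x / 2).
Proof.
move=> x0; have c0 : 0 <= 1 - cos x by rewrite subr_ge0 cos_le1.
have h1 := ler_wpM2r c0 (sin_le x x0); apply: le_trans h1 _.
by rewrite ler_wpM2l//; have := cos_ge x; lra.
Qed.

(** With b = |xi|/r, the integral over [-u, u] of 1 - cos(2bs) minus that of 1 - cos(bs) is 2
    sin(bu)(1 - cos(bu))/b. For every u it is at most c times the integral of [kap r], and
    majorization carries this over to [nu]. *)
Lemma psi_double_le (D r : R) (xi : Rd R n.+1) : 1 <= D -> 0 < r -> dotd xi xi <= D ->
  fine (psi nu (scaled n.+1 (2 / r) xi)) <=
  fine (psi nu (scaled n.+1 r^-1 xi)) + 6 * D ^+ 2 / normd xi * K1 nu r.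
Proof.
move=> D1 r0 xiD; set rho := normd xi.
have rho2 : rho ^+ 2 <= D by rewrite sqr_normd.
(* At the origin the correction term is 0 because [0^-1 = 0], and both sides are the exponent at
   0. *)
have [rho0|rho0] := eqVneq rho 0.
  rewrite rho0 invr0 mulr0 mul0r addr0 (psi_axis (scaled _ _ _)) (psi_axis (scaled _ r^-1 _)).
  rewrite !normd_scaled ?invr_ge0 ?divr_ge0 ?(ltW r0)//.
  by rewrite -/rho rho0 !mulr0.
have rhop : 0 < rho by rewrite lt_neqAle eq_sym rho0 normd_ge0.
set b := rho / r; have b0 : 0 < b by rewrite divr_gt0.
(* Multiplied by the 2/3 of [integral_kap_ge] this is 4 D^2/rho: the part 4/rho serves u > r, the
   factor D^2 serves u <= r. *)
set c := 6 * D ^+ 2 / rho.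
have c0 : 0 <= c by rewrite /c divr_ge0 ?(ltW rhop)// mulr_ge0 ?sqr_ge0//.
rewrite -lee_fin EFinD !fineK ?psi_fin// EFinM K1E//.
rewrite (psi_axis (scaled _ _ _)) (psi_axis (scaled _ r^-1 _)).
rewrite !normd_scaled ?invr_ge0 ?divr_ge0 ?(ltW r0)// -/rho.
have -> : 2 / r * rho = 2 * b by rewrite /b; ring.
have -> : r^-1 * rho = b by rewrite /b mulrC.
have mk := mfnu1 _ (measurable_kap r).
have k0 y : (0 <= (kap r y.1 * nu y)%:E)%E.
  by apply: (fnu0 (fun y => kap r y.1)) => z; exact: kap_ge0.
rewrite -ge0_integralZl//= -ge0_integralD//; last 4 first.
- by move=> y _; apply: (fnu0 (fun y => 1 - cos (b * y.1))) => z; exact: cosb0.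
- exact: mfnu1 (mcosb b).
- by move=> y _; rewrite mule_ge0.
- exact: emeasurable_funM.
under [leRHS]eq_integral do rewrite -EFinM -EFinD mulrA -mulrDl.
have ml : measurable_fun setT (fun s => 1 - cos (b * s) + c * kap r s).
  by apply: measurable_funD => //; apply: measurable_funM => //; exact: measurable_kap.
have l0 s : 0 <= 1 - cos (b * s) + c * kap r s.
  by rewrite addr_ge0// mulr_ge0// kap_ge0.
apply: (majorization_lebd _ _ _ _ (mcosb (2 * b)) (cosb0 (2 * b)) ml l0) => //.
move=> u u0.
have mkE : measurable_fun `[(- u)%R, u] (fun s : measurableTypeR R => (kap r s)%:E).
  by apply/measurable_EFinP; apply: measurable_funTS; exact: measurable_kap.
under [leRHS]eq_integral do rewrite EFinD EFinM.
have mcE : measurable_fun `[(- u)%R, u] (fun s : measurableTypeR R => (1 - cos (b * s))%:E).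
  by apply/measurable_EFinP; apply: measurable_funTS; exact: mcosb.
have kE0 (s : measurableTypeR R) : `[(- u)%R, u]%classic s -> (0 <= (kap r s)%:E)%E.
  by rewrite lee_fin kap_ge0.
have ckE0 (s : measurableTypeR R) : `[(- u)%R, u]%classic s -> (0 <= c%:E * (kap r s)%:E)%E.
  by rewrite -EFinM lee_fin mulr_ge0// kap_ge0.
have cE0 (s : measurableTypeR R) : `[(- u)%R, u]%classic s -> (0 <= (1 - cos (b * s))%:E)%E.
  by rewrite lee_fin.
rewrite (ge0_integralD leb (measurable_itv _) cE0 mcE ckE0); last exact: emeasurable_funM.
rewrite (ge0_integralZl leb (measurable_itv _) mkE kE0) ?lee_fin//.
have bn0 : b != 0 by rewrite gt_eqF.
have b2n0 : 2 * b != 0 by rewrite mulf_neq0 ?pnatr_eq0.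
rewrite !integral_one_sub_cos//.
have := integral_kap_ge r u r0 u0.
move=> /(lee_wpmul2l (x := c%:E)); rewrite lee_fin => /(_ c0).
move=> /(leeD (lexx (2 * (u - sin (b * u) / b))%:E)); apply: le_trans.
rewrite -EFinM -EFinD lee_fin -subr_ge0.
have -> : sin (2 * b * u) = 2 * (sin (b * u) * cos (b * u)).
  by rewrite -mulrA [2 * (b * u)]mulr_natl sin_mulr2n -mulr_natl; ring.
have bu0 : 0 <= b * u by rewrite mulr_ge0// ltW.
have -> : 2 * (u - sin (b * u) / b) + c * (2 / 3 * (r ^- 2 * Num.min u r ^+ 3))
   - 2 * (u - 2 * (sin (b * u) * cos (b * u)) / (2 * b))
   = c * (2 / 3) * (r ^- 2 * Num.min u r ^+ 3) - 2 * (sin (b * u) * (1 - cos (b * u))) / b.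
  by field; rewrite ?(gt_eqF b0) ?(gt_eqF r0) ?(gt_eqF rhop).
rewrite subr_ge0.
have -> : c * (2 / 3) = 4 * D ^+ 2 / rho by rewrite /c; field.
have D2 : 1 <= D ^+ 2 by rewrite expr2 -[1]mulr1 ler_pM.
(* Up to r, sin x (1 - cos x) <= x^3/2 gives the cubic b^2 u^3, and rho^3 <= D^2 suffices. Beyond r
   the bound for [kap] stays constant, and sin x (1 - cos x) <= 2 gives 4/b. *)
have [ur|ru] := leP u r.
  have := sin_one_sub_cos_le _ bu0 => h.
  apply: (@le_trans _ _ (2 * (b * u * (b * u * (b * u) / 2)) / b)).
    by rewrite ler_wpM2r ?invr_ge0 ?(ltW b0)// ler_wpM2l.
  have -> : 2 * (b * u * (b * u * (b * u) / 2)) / b = rho ^+ 2 * (r ^- 2 * u ^+ 3).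
    by rewrite /b; field; rewrite ?(gt_eqF b0) ?(gt_eqF r0) ?(gt_eqF rhop).
  rewrite ler_wpM2r ?mulr_ge0 ?invr_ge0 ?exprn_ge0// ?(ltW r0)//.
  rewrite ler_pdivlMr//.
  have rhoD : rho <= D.
    by have [h1|h1] := leP rho 1; [apply: le_trans D1|nra].
  have h3 : rho ^+ 2 * rho <= D * D by rewrite ler_pM// ?sqr_ge0// ltW.
  have h4 : 0 <= D * D by rewrite -expr2 sqr_ge0.
  by rewrite [D ^+ 2]expr2; lra.
apply: (@le_trans _ _ (2 * 2 / b)).
  rewrite ler_wpM2r ?invr_ge0 ?(ltW b0)// ler_wpM2l//.
  have h1 := sin_le1 (b * u); have h2 := cosb0 b u; have h3 := cos_geN1 (b * u).
  by have := ler_wpM2r h2 h1; lra.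
have -> : 4 * D ^+ 2 / rho * (r ^- 2 * r ^+ 3) = D ^+ 2 * (4 * (r / rho)).
  by field; rewrite ?(gt_eqF b0) ?(gt_eqF r0) ?(gt_eqF rhop).
have -> : 2 * 2 / b = 4 * (r / rho).
  by rewrite /b; field; rewrite ?(gt_eqF b0) ?(gt_eqF r0) ?(gt_eqF rhop).
by rewrite ler_peMl// mulr_ge0// divr_ge0// ltW.
Qed.

Let min1_ge0 (t : R) : 0 <= t -> 0 <= Num.min 1 t.
Proof. by move=> t0; rewrite le_min ler01. Qed.

Let mmin1 (r : R) : measurable_fun setT (fun s : R => Num.min 1 (r ^- 2 * s ^+ 2)).
Proof.
by apply: measurable_minr => //; apply: measurable_funM.
Qed.

Let min1r_ge0 (r s : R) : 0 <= Num.min 1 (r ^- 2 * s ^+ 2).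
Proof. by rewrite min1_ge0// mulr_ge0 ?invr_ge0 ?sqr_ge0. Qed.

Let integral_min1_le (r u : R) : 0 < r -> 0 <= u ->
  (\int[leb]_(s in `[(- u)%R, u]) (Num.min 1 (r ^- 2 * s ^+ 2))%:E <=
   (2 * u * Num.min 1 (r ^- 2 * u ^+ 2))%:E)%E.
Proof.
move=> r0 u0.
have mu : leb `[(- u)%R, u]%classic = (2 * u)%:E.
  rewrite lebesgue_measure_itv/= lte_fin; case: ifPn => h.
    by rewrite -EFinB; congr EFin; ring.
  by congr EFin; lra.
apply: (@le_trans _ _ (\int[leb]_(s in `[(- u)%R, u])
   (cst (Num.min 1 (r ^- 2 * u ^+ 2))%:E s))%E).
  apply: ge0_le_integral => //.
  - by move=> s _; rewrite lee_fin.
  - by apply/measurable_EFinP; apply: measurable_funTS; exact: mmin1.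
  - move=> s /=; rewrite in_itv/= -ler_norml => su; rewrite lee_fin.
    rewrite le_min !ge_min lexx/=; apply/orP; right.
    rewrite ler_wpM2l ?invr_ge0 ?sqr_ge0// -[s ^+ 2]real_normK ?num_real//.
    by rewrite lerXn2r ?nnegrE.
rewrite integral_cst//= mu -EFinM lee_fin; lra.
Qed.

Let min1_mul (a b : R) : 0 <= a <= 1 -> 0 <= b -> a * Num.min 1 b <= Num.min 1 (a * b).
Proof.
move=> /andP[a0 a1] b0; rewrite minr_pMr// mulr1 le_min !ge_min a1 lexx.
by rewrite orbT.
Qed.

(** Over [-u, u], 1 - cos(bs) integrates to at least u min(1, (bu)^2)/12 by [sub_sin_ge], the
    truncated square to at most 2u min(1, (u/r)^2). Since |xi|^2/D is at most 1, it can be moved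
    inside the minimum; hence the constant 24 D. *)
Lemma psi_ge_axis (D r : R) (xi : Rd R n.+1) : 1 <= D -> 0 < r -> dotd xi xi <= D ->
  ((dotd xi xi / (24 * D))%:E *
     \int[lam]_y (Num.min 1 (r ^- 2 * y.1 ^+ 2) * nu y)%:E
   <= psi nu (scaled n.+1 r^-1 xi))%E.
Proof.
move=> D1 r0 xiD; rewrite -sqr_normd; set rho := normd xi.
have rho2 : rho ^+ 2 <= D by rewrite sqr_normd.
have D0 : 0 < D by lra.
rewrite psi_axis normd_scaled ?invr_ge0 ?(ltW r0)// -/rho.
have [rho0|rho0] := eqVneq rho 0.
  rewrite rho0 expr0n/= mul0r mul0e; apply: integral_ge0 => y _.
  by rewrite lee_fin mulr_ge0.
have rhop : 0 < rho by rewrite lt_neqAle eq_sym rho0 normd_ge0.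
set b := r^-1 * rho; have b0 : 0 < b by rewrite mulr_gt0 ?invr_gt0.
set c := rho ^+ 2 / (24 * D).
have c0 : 0 <= c by rewrite /c divr_ge0 ?sqr_ge0// mulr_ge0// ltW.
have mk := mfnu1 _ (mmin1 r).
rewrite -ge0_integralZl//=; last first.
  by move=> y _; rewrite lee_fin mulr_ge0.
under [leLHS]eq_integral do rewrite -EFinM mulrA.
have ml : measurable_fun setT (fun s : R => c * Num.min 1 (r ^- 2 * s ^+ 2)).
  by apply: measurable_funM => //; exact: mmin1.
have l0 (s : R) : 0 <= c * Num.min 1 (r ^- 2 * s ^+ 2) by rewrite mulr_ge0.
apply: (majorization_lebd _ _ _ _ ml l0 (mcosb b) (cosb0 b)) => //.
move=> u u0.
have mkE : measurable_fun `[(- u)%R, u]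
    (fun s : measurableTypeR R => (Num.min 1 (r ^- 2 * s ^+ 2))%:E).
  by apply/measurable_EFinP; apply: measurable_funTS; exact: mmin1.
have kE0 (s : measurableTypeR R) : `[(- u)%R, u]%classic s ->
    (0 <= (Num.min 1 (r ^- 2 * s ^+ 2))%:E)%E by rewrite lee_fin.
under [leLHS]eq_integral do rewrite EFinM.
rewrite (ge0_integralZl leb (measurable_itv _) mkE kE0) ?lee_fin//.
rewrite integral_one_sub_cos ?(gt_eqF b0)//.
have := integral_min1_le r u r0 u0.
move=> /(lee_wpmul2l (x := c%:E)); rewrite lee_fin => /(_ c0).
move=> h; apply: le_trans h _; rewrite -EFinM lee_fin.
have bu0 : 0 <= b * u by rewrite mulr_ge0// ltW.
have := sub_sin_ge _ bu0 => h1.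
have -> : 2 * (u - sin (b * u) / b) = 2 / b * (b * u - sin (b * u)).
  by field; rewrite (gt_eqF b0).
apply: le_trans (ler_wpM2l _ h1); last by rewrite divr_ge0// ltW.
have -> : 2 / b * (b * u * Num.min 1 (b * u * (b * u)) / 24)
    = 2 * u / 24 * Num.min 1 (b * u * (b * u)).
  by field; rewrite (gt_eqF b0).
have -> : c * (2 * u * Num.min 1 (r ^- 2 * u ^+ 2))
    = 2 * u / 24 * (rho ^+ 2 / D * Num.min 1 (r ^- 2 * u ^+ 2)).
  by rewrite /c; field; rewrite (gt_eqF D0).
have -> : b * u * (b * u) = rho ^+ 2 * (r ^- 2 * u ^+ 2).
  by rewrite /b; field; rewrite (gt_eqF r0).
rewrite ler_wpM2l//; first by rewrite divr_ge0 ?mulr_ge0.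
have i0 : 0 <= r ^- 2 * u ^+ 2 by rewrite mulr_ge0 ?invr_ge0 ?sqr_ge0.
apply: le_trans (min1_mul _ _ _ i0) _.
  by rewrite divr_ge0 ?sqr_ge0 ?(ltW D0)//= ler_pdivrMr// mul1r.
rewrite le_min !ge_min lexx/=; apply/orP; right.
by rewrite ler_wpM2r// ler_pdivrMr// ler_peMr// sqr_ge0.
Qed.

(** The truncation at 1 of a sum of squares is at most the sum of the truncations, and by rotation
    each of the n + 2 coordinates contributes the same integral. *)
Lemma hfun_le_axis (r : R) : 0 < r -> ((hfun nu r)%:E <=
  n.+2%:R%:E * \int[lam]_y (Num.min 1 (r ^- 2 * y.1 ^+ 2) * nu y)%:E)%E.
Proof.
move=> r0; rewrite hfunE//.
have mi i : measurable_fun setT (fun y : Rd R n.+1 =>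
    (Num.min 1 (r ^- 2 * dotd (unitd n.+1 i) y ^+ 2) * nu y)%:E).
  apply: (mfnu (fun y => Num.min 1 (r ^- 2 * dotd (unitd n.+1 i) y ^+ 2))).
  by apply: (measurableT_comp (mmin1 r)); exact: measurable_dotd.
have i0 (i : nat) y : (0 <= (Num.min 1 (r ^- 2 * dotd (unitd n.+1 i) y ^+ 2) * nu y)%:E)%E.
  by rewrite lee_fin mulr_ge0.
apply: (@le_trans _ _ (\int[lam]_y \sum_(i < n.+2)
    (Num.min 1 (r ^- 2 * dotd (unitd n.+1 i) y ^+ 2) * nu y)%:E)%E).
  apply: ge0_le_integral => //.
  - by move=> y _; rewrite lee_fin mulr_ge0.
  - apply: (mfnu (fun y => Num.min 1 (r ^- 2 * normd y ^+ 2))).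
    by apply: (measurableT_comp (mmin1 r)); exact: measurable_normd.
  - exact: emeasurable_sum.
  - move=> y _; rewrite sumEFin lee_fin -mulr_suml ler_wpM2r//.
    rewrite sqr_normd -sum_unitd mulr_sumr.
    by apply: min1_sum => i; rewrite mulr_ge0 ?invr_ge0 ?sqr_ge0.
rewrite ge0_integral_sum//.
rewrite (eq_bigr (fun=> \int[lam]_y (Num.min 1 (r ^- 2 * y.1 ^+ 2) * nu y)%:E)%E).
  by rewrite sumr_const card_ord mule_natl.
move=> i _.
rewrite (integral_nu_rotation (unitd n.+1 i) (fun s => Num.min 1 (r ^- 2 * s ^+ 2)))//.
- by rewrite normd_unitd; under eq_integral do rewrite mul1r.
- by move=> s; rewrite sqrrN.
Qed.

Lemma psi_ge (D r : R) (xi : Rd R n.+1) : 1 <= D -> 0 < r -> dotd xi xi <= D ->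
  dotd xi xi / (24 * D * n.+2%:R) * hfun nu r <= fine (psi nu (scaled n.+1 r^-1 xi)).
Proof.
move=> D1 r0 xiD; have := psi_ge_axis D r xi D1 r0 xiD; have := hfun_le_axis r r0.
rewrite -[psi _ _]fineK ?psi_fin//.
set I := (\int[lam]_y _)%E => h1 h2.
have n0 : 0 < n.+2%:R :> R by rewrite ltr0n.
have x0 : 0 <= dotd xi xi by exact: dotd_ge0.
rewrite -lee_fin; apply: le_trans h2.
have c0 : 0 <= dotd xi xi / (24 * D * n.+2%:R).
  by rewrite divr_ge0// !mulr_ge0//; lra.
rewrite EFinM; apply: le_trans (lee_wpmul2l _ h1) _; first by rewrite lee_fin.
rewrite muleA -EFinM.
have -> // : dotd xi xi / (24 * D * n.+2%:R) * n.+2%:R = dotd xi xi / (24 * D).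
by rewrite invfM mulrA mulfVK// gt_eqF.
Qed.

End levy_density.

(** * Integrals in time and the integral of T(xi) |xi|^-5 *)

Section integrals.
Context {R : realType}.
Local Notation leb := (@lebesgue_measure R).
Local Open Scope ereal_scope.

(* Needed because [t |-> mu t A] is not assumed measurable; it holds because the
   integral of a nonnegative function is a supremum over simple functions. *)
Lemma ge0_le_integral_nonmeasurable {d : measure_display} {T : measurableType d}
    (m : {measure set T -> \bar R}) (D : set T) (f g : T -> \bar R) :
  (forall x, D x -> 0 <= f x) -> (forall x, D x -> f x <= g x) ->
  \int[m]_(x in D) f x <= \int[m]_(x in D) g x.
Proof.
move=> f0 fg; rewrite !ge0_integralE//; last first.
  by move=> x Dx; exact: le_trans (f0 _ Dx) (fg _ Dx).
apply: le_ereal_sup => _ [h /= hf <-]; exists h => // x.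
by apply: le_trans (hf x) _; rewrite !patchE; case: ifPn => // /set_mem/fg.
Qed.

(** The bound t <= (2/th) exp(t th/2) reduces the integrand to a multiple of the exponential density
    of rate th/2, whose integral is 1; this accounts for the 4. *)
Lemma integral_id_mul_expRN_le (th : R) : (0 < th)%R ->
  \int[leb]_(t in [set t : R | (0 <= t)%R]) (t * expR (- (t * th)))%:E
  <= (4 / th ^+ 2)%:E.
Proof.
move=> th0; have th20 : (0 < th / 2)%R by rewrite divr_gt0.
have mp : measurable_fun setT (fun t : measurableTypeR R => (exponential_pdf (th / 2) t)%:E).
  by apply/measurable_EFinP; exact: measurable_exponential_pdf.
have p0 (t : R) : 0 <= (exponential_pdf (th / 2) t)%:E.
  by rewrite lee_fin exponential_pdf_ge0// ltW.
apply: (@le_trans _ _ (\int[leb]_t ((4 / th ^+ 2)%:E * (exponential_pdf (th / 2) t)%:E))).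
  rewrite integral_mkcond; apply: ge0_le_integral_nonmeasurable.
    move=> t _; apply: erestrict_ge0 => s s0.
    by rewrite lee_fin mulr_ge0 ?expR_ge0.
  move=> t _; rewrite patchE; case: ifPn => [/set_mem/= t0|_]; last first.
    by rewrite mule_ge0// lee_fin divr_ge0 ?sqr_ge0.
  rewrite -EFinM lee_fin exponential_pdfE//.
  have -> : expR (- (t * th)) = (expR (- (th / 2) * t) * expR (- (th / 2) * t))%R.
    by rewrite -expRD; congr expR; field.
  have -> : (4 / th ^+ 2 * (th / 2 * expR (- (th / 2) * t)))%R
     = (2 / th * expR (- (th / 2) * t))%R by field; rewrite gt_eqF.
  rewrite mulrA ler_wpM2r ?expR_ge0//.
  rewrite mulNr expRN ler_pdivrMr ?expR_gt0//.
  have := expR_ge1Dx (th / 2 * t); set e := expR _ => he.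
  have {1}-> : t = (2 / th * (th / 2 * t))%R by field; rewrite gt_eqF.
  by rewrite ler_wpM2l ?divr_ge0 ?(ltW th0)//; lra.
rewrite ge0_integralZl//; last by rewrite lee_fin divr_ge0 ?sqr_ge0.
by rewrite integral_exponential_pdf// mule1.
Qed.

Lemma normd_le_boxd m (e : R) (x : Rd R m) : (normd x <= e)%R -> boxd m (- e) e x.
Proof.
move=> xe; have e0 : (0 <= e)%R by exact: le_trans (normd_ge0 _ x) xe.
have : (dotd x x <= e ^+ 2)%R.
  by rewrite -sqr_normd lerXn2r ?nnegrE// normd_ge0.
have key (s : R) : (s * s <= e ^+ 2)%R -> `[(- e)%R, e]%classic s.
  rewrite -expr2 /= in_itv/= -ler_norml -[(s ^+ 2)%R]real_normK ?num_real//.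
  by rewrite ler_pXn2r ?nnegrE.
elim: m x {xe} => [|m ih] x /= h; first exact: key.
split=> /=.
  by apply: key; apply: le_trans h; rewrite lerDl dotd_ge0.
by apply: ih; apply: le_trans h; rewrite lerDr -expr2 sqr_ge0.
Qed.

Lemma dyadic_scale (rho : R) : (0 < rho < 1)%R ->
  exists k : nat, (rho <= 2 ^- k < 2 * rho)%R.
Proof.
move=> /andP[r0 r1].
have ex : exists k : nat, (2 ^- k < rho)%R.
  have h := truncnS_gt rho^-1; set k := (Num.truncn _).+1 in h; exists k.
  rewrite invf_plt ?posrE ?exprn_gt0//; apply: lt_trans h _.
  by rewrite -natrX ltr_nat ltn_expl.
case: (ex_minnP ex) => -[|k].
  by rewrite expr0 invr1 ltNge (ltW r1).
move=> kr kmin; exists k; apply/andP; split.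
  by rewrite leNgt; apply/negP => /kmin; rewrite ltnn.
by move: kr; rewrite exprS invfM mulrC ltr_pdivrMr// mulrC.
Qed.

Lemma integral_trid n : \int[lebd R n]_x (trid n x)%:E = 1.
Proof.
have := integral_trid_cos n 0 0 (zerod R n).
rewrite normr0 ler01 !mul0r addr0 => /(_ isT) <-.
by apply: eq_integral => x _; rewrite mul0r addr0 mulr1.
Qed.

(** For |x| >= 1 the integrand is at most [trid]. Below 1, |x|^-5 <= 2^(5(k+1)) for a k with |x| <=
    2^-k, and that ball lies in a cube of volume (2 2^-k)^(n+2). As n + 2 >= 6, the sum over k is
    dominated by a geometric series. *)
Lemma integral_trid_normdV5_lty n : (4 <= n)%N ->
  \int[lebd R n.+1]_x (trid n.+1 x * normd x ^- 5)%:E < +oo.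
Proof.
move=> n4.
have mE k : measurable [set x : Rd R n.+1 | (normd x <= 2 ^- k)%R].
  apply: (@measurable_set_bool _ _ (fun x : Rd R n.+1 => (normd x <= 2 ^- k)%R)).
  by apply: measurable_fun_ler => //; exact: measurable_normd.
pose f k (x : Rd R n.+1) : \bar R :=
  ((2 ^+ (5 * k.+1))%:E * (\1_[set x : Rd R n.+1 | (normd x <= 2 ^- k)%R] x)%:E).
have f0 k x : 0 <= f k x by rewrite mule_ge0// lee_fin exprn_ge0.
have mf k : measurable_fun setT (f k).
  by apply: emeasurable_funM => //; apply/measurable_EFinP; exact: measurable_indic.
apply: (@le_lt_trans _ _ (\int[lebd R n.+1]_x ((trid n.+1 x)%:E + \sum_(k <oo) f k x))).
  apply: ge0_le_integral_nonmeasurable => // x _.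
    by rewrite lee_fin mulr_ge0 ?trid_ge0// invr_ge0 exprn_ge0// normd_ge0.
  have s0 : 0 <= \sum_(k <oo) f k x by apply: nneseries_ge0.
  have [x1|x1] := leP 1%R (normd x).
    apply: (@le_trans _ _ ((trid n.+1 x)%:E)); last by rewrite leeDl.
    rewrite lee_fin ler_piMr ?trid_ge0// invf_le1 ?exprn_ege1//.
    by rewrite exprn_gt0// (lt_le_trans ltr01).
  (* At the origin the integrand is 0, by the convention for the inverse of 0. *)
  have [x0|x0] := eqVneq (normd x) 0%R.
    have -> : (normd x ^- 5 = 0)%R by rewrite x0 expr0n invr0.
    by rewrite mulr0 adde_ge0// lee_fin trid_ge0.
  have xp : (0 < normd x)%R by rewrite lt_neqAle eq_sym x0 normd_ge0.
  have [|k /andP[k1 k2]] := dyadic_scale (normd x); first by rewrite xp.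
  apply: (@le_trans _ _ (f k x)).
    rewrite /f indicE mem_set// mule1 lee_fin.
    apply: (@le_trans _ _ (normd x ^- 5)).
      by rewrite ler_piMl ?trid_le1// invr_ge0 exprn_ge0// normd_ge0.
    rewrite mulnC exprM -exprVn lerXn2r ?nnegrE ?invr_ge0 ?normd_ge0 ?exprn_ge0//.
    rewrite exprS -[leLHS]mul1r ler_pdivrMr// -mulrA -ler_pdivrMl//.
    rewrite mulr1 mulrC -ler_pdivrMr ?exprn_gt0// mulrC.
    by move: k2; lra.
  apply: (@le_trans _ _ (\sum_(k <oo) f k x)); last by rewrite leeDr// lee_fin trid_ge0.
  apply: le_trans (nneseries_lim_ge k.+1 _) => //.
  by rewrite big_nat_recr//= leeDr// sume_ge0.
rewrite ge0_integralD//; last 4 first.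
- by move=> x _; rewrite lee_fin trid_ge0.
- by apply/measurable_EFinP; exact: measurable_trid.
- by move=> x _; apply: nneseries_ge0.
- exact: ge0_emeasurable_sum.
rewrite integral_trid integral_nneseries//.
(* The term equals 2^(n+7) 2^-k, written in the shape of the geometric series summed at the end. *)
apply: (@le_lt_trans _ _ (1 + \sum_(k <oo) (2 ^+ (n + 8) / (2 ^ (k + 1))%:R)%:E)).
  rewrite leeD2l//; apply: lee_nneseries => [k _ _|k _].
    exact: integral_ge0.
  rewrite /f ge0_integralZl//; last first.
    by apply/measurable_EFinP; exact: measurable_indic.
  rewrite integral_indic// setIT.
  have e0 : (0 <= 2 ^- k :> R)%R by rewrite invr_ge0 exprn_ge0.
  apply: (@le_trans _ _ ((2 ^+ (5 * k.+1))%:E * lebd R n.+1 (boxd n.+1 (- 2 ^- k) (2 ^- k)))).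
    apply: lee_wpmul2l; first by rewrite lee_fin exprn_ge0.
    apply: le_measure; rewrite ?inE//; first exact: measurable_boxd.
    by move=> x; exact: normd_le_boxd.
  rewrite lebd_boxd; last by lra.
  rewrite -EFinM lee_fin; set e := (2 ^- k)%R.
  have e1 : (e <= 1)%R by rewrite /e invf_le1 ?exprn_gt0// exprn_ege1// ler1n.
  have k0 : (2 ^+ k != 0 :> R)%R by rewrite expf_neq0// pnatr_eq0.
  have -> : (2 ^+ (5 * k.+1) = 2 ^+ 5 * e ^- 5 :> R)%R.
    by rewrite mulnS exprD /e -exprVn invrK -exprM mulnC.
  have -> : (e - - e = 2 * e)%R by ring.
  rewrite [((2 * e) ^+ _)%R]exprMn.
  have h6 : (e ^+ n.+2 <= e ^+ 6)%R by rewrite ler_wiXn2l.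
  have -> : (2 ^+ (n + 8) / (2 ^ (k + 1))%:R = 2 ^+ (n + 7) * e)%R.
    by rewrite /e addn1 natrX exprS addnS exprS; field.
  have -> : (2 ^+ 5 * e ^- 5 * (2 ^+ n.+2 * e ^+ n.+2) =
     2 ^+ (n + 7) * (e ^- 5 * e ^+ n.+2))%R.
    by rewrite (_ : (n + 7 = 5 + n.+2)%N) ?exprD; [ring|by rewrite addnC].
  rewrite ler_wpM2l ?exprn_ge0//.
  apply: (@le_trans _ _ (e ^- 5 * e ^+ 6)%R).
    by rewrite ler_wpM2l ?invr_ge0 ?exprn_ge0.
  by rewrite [(e ^+ 6)%R]exprS mulrCA mulVf ?mulr1// expf_neq0// invr_eq0.
rewrite (cvg_lim _ (@cvg_geometric_eseries_half R (2 ^+ (n + 8))%R 0))//.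
by rewrite -EFinD ltry.
Qed.

End integrals.

(** * The process: probability and potential of the box *)

Definition box_gap (R : realType) (n : nat) : R :=
  (2 * n.+2%:R)^-1 * (2 * n.+2%:R)^-1 / 16 / 2 ^+ n.+1.

Section process.
Context {R : realType} {n : nat}.
Variables (nu : Rd R n.+1 -> R) (mu : R -> probability (Rd R n.+1) R).
Hypotheses (nuP : iso_unimodal_levy_density nu) (muP : levy_law nu mu).
Local Notation leb := (@lebesgue_measure R).
Local Notation lam := (lebd R n.+1).
(* [Rd R n.+1] has dimension [n.+2]. *)
Local Notation D := (n.+2%:R : R).

Let mcos : measurable_fun setT (@cos R).
Proof. by apply: continuous_measurable_fun; exact: continuous_cos. Qed.

Lemma measurable_psi a :
  measurable_fun setT (fun xi : Rd R n.+1 => fine (psi nu (scaled n.+1 a xi))).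
Proof.
have [mnu nu0 _ _ _] := nuP.
have mpsi : measurable_fun setT (psi nu).
  apply: (measurable_fun_fubini_tonelli_F (m2 := lam)
    (fun z : Rd R n.+1 * Rd R n.+1 => ((1 - cos (dotd z.1 z.2)) * nu z.2)%:E)).
    apply/measurable_EFinP; apply: measurable_funM; last first.
      exact: (measurableT_comp mnu measurable_snd).
    apply: measurable_funB => //; apply: (measurableT_comp mcos).
    by apply: measurable_dotd; [exact: measurable_fst|exact: measurable_snd].
  by move=> z; rewrite lee_fin mulr_ge0// subr_ge0 cos_le1.
apply: (measurableT_comp (f := fine)); first exact: fine_measurable.
exact: (measurableT_comp mpsi (measurable_scaled _ _)).
Qed.

Let F a (z : Rd R n.+1 * Rd R n.+1) : \bar R :=
  (trid n.+1 z.2 * (1 + cos (dotd z.2 (scaled n.+1 a z.1))))%:E.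

Let mF a : measurable_fun setT (F a).
Proof.
apply/measurable_EFinP; apply: measurable_funM.
  exact: (measurableT_comp (measurable_trid _) measurable_snd).
apply: measurable_funD => //; apply: (measurableT_comp mcos).
apply: measurable_dotd; first exact: measurable_snd.
exact: (measurableT_comp (measurable_scaled _ _) measurable_fst).
Qed.

Let F0 a z : (0 <= F a z)%E.
Proof.
by rewrite lee_fin mulr_ge0 ?trid_ge0//; have := cos_geN1 (dotd z.2 (scaled n.+1 a z.1)); lra.
Qed.

Let integralF a y :
  (\int[lam]_xi F a (y, xi) = (1 + sinc2d n.+1 (scaled n.+1 a y))%:E)%E.
Proof.
have := integral_trid_cos n.+1 1 0 (scaled n.+1 a y).
rewrite normr1 lexx cos0 !mul1r => /(_ isT) <-.
by apply: eq_integral => xi _; rewrite /F add0r mul1r.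
Qed.

Let measurable_sinc2d_scaled a :
  measurable_fun setT (fun y : Rd R n.+1 => (1 + sinc2d n.+1 (scaled n.+1 a y))%:E).
Proof.
under eq_fun do rewrite -integralF.
exact: (measurable_fun_fubini_tonelli_F (m2 := lam) (F a)).
Qed.

Let one_add_chf (a t : R) (xi : Rd R n.+1) : R := 1 + expR (- (t * fine (psi nu (scaled n.+1 a xi)))).

Lemma integral_one_add_cos (t : R) (xi : Rd R n.+1) : 0 <= t ->
  (\int[mu t]_y (1 + cos (dotd xi y))%:E = (1 + expR (- (t * fine (psi nu xi))))%:E)%E.
Proof.
move=> t0; have [h _] := muP t t0 xi.
have i1 : (mu t).-integrable setT (EFin \o cst (1 : R)).
  by apply: finite_measure_integrable_cst.
have i2 : (mu t).-integrable setT (EFin \o (fun y => cos (dotd xi y))).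
  apply: measurable_bounded_integrable => //.
  - by apply: le_lt_trans (probability_le1 (mu t) measurableT) _; rewrite ltry.
  - by apply: (measurableT_comp mcos); exact: measurable_dotd.
  - exists 1; split => // x x1 y _; exact: le_trans (cos_max _) (ltW x1).
have := integralD_EFin measurableT i1 i2; rewrite /= h => ->.
rewrite integral_cst//; transitivity (1 * 1 + (expR (- (t * fine (psi nu xi))))%:E)%E.
  by congr (_ * _ + _)%E; exact: probability_setT.
by rewrite mule1 EFinD.
Qed.

(** Tonelli for [F]: integrating in [xi] gives 1 + sinc2d, integrating in [y] gives the
    characteristic function of the law at time t. *)
Lemma integral_one_add_sinc2d (a t : R) : 0 <= t ->
  (\int[mu t]_y (1 + sinc2d n.+1 (scaled n.+1 a y))%:E
   = \int[lam]_xi (trid n.+1 xi * (1 + expR (- (t * fine (psi nu (scaled n.+1 a xi))))))%:E)%E.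
Proof.
move=> t0; under eq_integral do rewrite -integralF.
rewrite (fubini_tonelli (m1 := mu t) (m2 := lam) (F a))//.
apply: eq_integral => xi _.
rewrite EFinM -integral_one_add_cos// -ge0_integralZl//.
- by apply: eq_integral => y _; rewrite /F -EFinM dotd_scaledl dotd_scaledr.
- apply/measurable_EFinP; apply: measurable_funD => //; apply: (measurableT_comp mcos).
  exact: measurable_dotd.
- by rewrite lee_fin trid_ge0.
Qed.

Lemma boxd_scaled m (r a b : R) (y : Rd R m) : 0 < r -> boxd m (r * a) (r * b) y ->
  boxd m a b (scaled m r^-1 y).
Proof.
move=> r0.
have key (s : R) : r * a <= s <= r * b -> a <= r^-1 * s <= b.
  by rewrite ler_pdivlMl// ler_pdivrMl.
elim: m y => [|m ih] y /=; rewrite !in_itv/=; first exact: key.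
by move=> [/key h1 /ih h2].
Qed.

(** [delta] is the bound of [psi_double_le] on the increment p(2 xi/r) - p(xi/r), [theta] the lower
    bound of [psi_ge] for p(xi/r). Both take for [D] the dimension, which bounds |xi|^2 on the
    support of [trid]. *)
Let delta (r : R) (xi : Rd R n.+1) : R := 6 * D ^+ 2 / normd xi * K1 nu r.
Let theta (r : R) (xi : Rd R n.+1) : R := dotd xi xi / (24 * D * D) * hfun nu r.
Local Notation gap := (box_gap R n).

Let D1 : 1 <= D. Proof. by rewrite ler1n. Qed.

(** From exp(-x) >= 1 - x with x = t dl: raising the exponent p by at most dl lowers exp(-tp) by at
    most t dl exp(-tp), and p >= th bounds the last factor. *)
Lemma expRN_gap (t p q dl th : R) : 0 <= t -> 0 <= dl -> q <= p + dl -> th <= p ->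
  expR (- (t * p)) <= expR (- (t * q)) + t * dl * expR (- (t * th)) :> R.
Proof.
move=> t0 dl0 qp thp.
have h1 : expR (- (t * p)) * (1 + - (t * dl)) <= expR (- (t * q)).
  apply: (@le_trans _ _ (expR (- (t * p)) * expR (- (t * dl)))).
    by rewrite ler_wpM2l ?expR_ge0// expR_ge1Dx.
  by rewrite -expRD ler_expR -opprD lerN2 -mulrDr ler_wpM2l.
have h2 : expR (- (t * p)) <= expR (- (t * th)).
  by rewrite ler_expR lerN2 ler_wpM2l.
have h3 := ler_wpM2l (mulr_ge0 t0 dl0) h2.
by lra.
Qed.

Let measurable_bound2 r : measurable_fun setT (fun z : measurableTypeR R * Rd R n.+1 =>
  z.1 * delta r z.2 * expR (- (z.1 * theta r z.2))).
Proof.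
have m1 : measurable_fun setT (fun z : measurableTypeR R * Rd R n.+1 => z.1).
  exact: measurable_fst.
have m2 : measurable_fun setT (fun z : measurableTypeR R * Rd R n.+1 => z.2).
  exact: measurable_snd.
apply: measurable_funM.
  apply: measurable_funM => //; apply: measurable_funM => //.
  apply: measurable_funM => //.
  under eq_fun do rewrite -powR_inv1 ?normd_ge0//.
  apply: (measurableT_comp (measurable_powR _)).
  exact: (measurable_normd _ _ m2).
apply: (measurableT_comp (@measurable_expR R)).
apply: (measurableT_comp (@oppr_measurable R setT)).
apply: measurable_funM => //; apply: measurable_funM => //.
by apply: measurable_funM => //; exact: measurable_dotd.
Qed.

Let measurable_bound r t : measurable_fun setT (fun xi =>
  t * delta r xi * expR (- (t * theta r xi))).
Proof. exact: (measurableT_comp (measurable_bound2 r) (pair1_measurable t)). Qed.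

(** With [A a] the common value of the two integrals in [integral_one_add_sinc2d], the pointwise gap
    gives gap P(X_t in B) + A(2/r) <= A(1/r), and the comparison of exponents gives A(1/r) <= A(2/r)
    + E. *)
Lemma box_probability_le (r t : R) : 0 < r -> 0 <= t ->
  (gap%:E * mu t (boxd n.+1 (r * (2 * D)^-1) (r * D^-1)) <=
   \int[lam]_xi (trid n.+1 xi * (t * delta r xi * expR (- (t * theta r xi))))%:E)%E.
Proof.
move=> r0 t0; set B := boxd _ _ _.
have mB : measurable B by exact: measurable_boxd.
have D0 : 0 < D by rewrite ltr0n.
have g0 : 0 <= gap by rewrite /box_gap !divr_ge0 ?mulr_ge0 ?invr_ge0 ?mulr_ge0 ?exprn_ge0.
pose A a := (\int[lam]_xi (trid n.+1 xi * one_add_chf a t xi)%:E)%E.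
set E := (\int[lam]_xi _)%E.
have mtri : measurable_fun setT (fun xi : Rd R n.+1 => (trid n.+1 xi)%:E).
  by apply/measurable_EFinP; exact: measurable_trid.
have mA a : measurable_fun setT (fun xi : Rd R n.+1 => (trid n.+1 xi * one_add_chf a t xi)%:E).
  apply/measurable_EFinP; apply: measurable_funM; first exact: measurable_trid.
  apply: measurable_funD => //; apply: (measurableT_comp (@measurable_expR R)).
  apply: (measurableT_comp (@oppr_measurable R setT)).
  by apply: measurable_funM => //; exact: measurable_psi.
have A0 a xi : (0 <= (trid n.+1 xi * one_add_chf a t xi)%:E)%E.
  rewrite lee_fin; apply: mulr_ge0; first exact: trid_ge0.
  exact: addr_ge0 ler01 (expR_ge0 _).
have Kr0 : 0 <= K1 nu r by exact: K1_ge0.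
have dl0 xi : 0 <= delta r xi.
  by rewrite /delta mulr_ge0// divr_ge0 ?normd_ge0// mulr_ge0// sqr_ge0.
have E0 xi : (0 <= (trid n.+1 xi * (t * delta r xi * expR (- (t * theta r xi))))%:E)%E.
  rewrite lee_fin; apply: mulr_ge0; first exact: trid_ge0.
  exact: mulr_ge0 (mulr_ge0 t0 (dl0 _)) (expR_ge0 _).
(* Finiteness allows A(2/r) to be cancelled among extended reals at the end. *)
have Afin a : A a \is a fin_num.
  rewrite ge0_fin_numE; last by apply: integral_ge0.
  apply: (@le_lt_trans _ _ (\int[lam]_xi (2%:E * (trid n.+1 xi)%:E))%E).
    apply: ge0_le_integral => //; first exact: emeasurable_funM.
    move=> xi _; rewrite -EFinM lee_fin mulrC ler_wpM2r ?trid_ge0//.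
    rewrite /one_add_chf -lerBrDl (_ : 2 - 1 = 1); last by lra.
    rewrite -expR0 ler_expR oppr_le0 mulr_ge0// fine_ge0//.
    have [_ nu0 _ _ _] := nuP.
    by apply: integral_ge0 => y _; rewrite lee_fin mulr_ge0// subr_ge0 cos_le1.
  rewrite ge0_integralZl// ?integral_trid ?mule1 ?ltry//.
  by move=> xi _; rewrite lee_fin trid_ge0.
have s1 : (gap%:E * mu t B + A (2 / r)%R <= A r^-1%R)%E.
  have AE a : A a = (\int[mu t]_y (1 + sinc2d n.+1 (scaled n.+1 a y))%:E)%E.
    exact/esym/integral_one_add_sinc2d.
  have muB : (\int[mu t]_y (\1_B y)%:E = mu t B)%E by rewrite integral_indic// setIT.
  rewrite !AE -muB -ge0_integralZl//; last first.
    by apply/measurable_EFinP; exact: measurable_indic.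
  have mi : measurable_fun setT (fun y : Rd R n.+1 => gap%:E * (\1_B y)%:E)%E.
    by apply: emeasurable_funM => //; apply/measurable_EFinP; exact: measurable_indic.
  rewrite -ge0_integralD//; last 2 first.
  - by move=> y _; rewrite mule_ge0// lee_fin.
  - by move=> y _; rewrite lee_fin addr_ge0// sinc2d_ge0.
  apply: ge0_le_integral_nonmeasurable => y _.
    by rewrite adde_ge0 ?mule_ge0 ?lee_fin// addr_ge0// sinc2d_ge0.
  rewrite -EFinM -EFinD lee_fin.
  have -> : scaled n.+1 (2 / r) y = scaled n.+1 2 (scaled n.+1 r^-1 y).
    by rewrite scaled_scaled.
  rewrite indicE; case: (boolP (y \in B)) => [/set_mem yB|_]; last first.
    by rewrite mulr0 add0r lerD2l sinc2d_double_le.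
  (* After division by r the coordinates lie in [1/(2D), 1/D]; [box_gap] is the gap for a =
     1/(2D). *)
  have := @sinc2d_double_gap _ n.+1 (2 * D)^-1 D^-1 (scaled n.+1 r^-1 y).
  rewrite invr_gt0 mulr_gt0// invf_le1// D1 => /(_ isT isT (boxd_scaled _ _ _ _ _ r0 yB)).
  by rewrite mulr1 -/(box_gap R n); lra.
have s2 : (A r^-1%R <= A (2 / r)%R + E)%E.
  rewrite /A /E -ge0_integralD//; last first.
    by apply/measurable_EFinP; apply: measurable_funM;
      [exact: measurable_trid|exact: measurable_bound].
  apply: ge0_le_integral_nonmeasurable => // xi _; rewrite -EFinD lee_fin -mulrDr.
  (* The bounds on the exponent require |xi|^2 <= D, which holds where [trid] is nonzero; elsewhere
     both sides vanish. *)
  have [->|/trid_support xiD] := eqVneq (trid n.+1 xi) 0; first by rewrite !mul0r.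
  rewrite ler_wpM2l ?trid_ge0// /one_add_chf -addrA lerD2l.
  apply: expRN_gap => //; first exact: psi_double_le.
  exact: psi_ge.
by have := le_trans s1 s2; rewrite [leRHS]addeC leeD2rE.
Qed.

(** The time integral is at most 4 delta/theta^2. Here 4 times 6 D^2 is 24 D^2, and the powers -1 of
    |xi| in [delta] and 2 in [theta] combine to -5. *)
Let integral_bound_le r (xi : Rd R n.+1) : 0 < r ->
  (\int[leb]_(t in [set t : R | (0 <= t)%R])
      (t * delta r xi * expR (- (t * theta r xi)))%:E
   <= (24 * D ^+ 2 * (24 * D * D) ^+ 2 * hfun nu r ^- 2 * K1 nu r * normd xi ^- 5)%:E)%E.
Proof.
move=> r0; have K0 : 0 <= K1 nu r by exact: K1_ge0.
have D0 : 0 < D by rewrite ltr0n.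
have mI : measurable [set t : measurableTypeR R | 0 <= t].
  apply: (@measurable_set_bool _ (measurableTypeR R) (fun t => 0 <= t)).
  exact: measurable_fun_ler.
have dl0 : 0 <= delta r xi.
  by rewrite /delta mulr_ge0// divr_ge0 ?normd_ge0// mulr_ge0// sqr_ge0.
(* If K_1(r) = 0, both sides vanish. Otherwise K_1 <= h forces h(r) > 0, which makes [theta]
   positive off the origin. *)
have [Kz|Kz] := eqVneq (K1 nu r) 0.
  rewrite Kz mulr0 mul0r integral0_eq// => t _.
  by rewrite /delta Kz !mulr0 mul0r.
have [xz|xz] := eqVneq (normd xi) 0.
  rewrite xz expr0n/= invr0 mulr0 integral0_eq// => t _.
  by rewrite /delta xz invr0 mulr0 mul0r mulr0 mul0r.
have xp : 0 < normd xi by rewrite lt_neqAle eq_sym xz normd_ge0.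
have hp : 0 < hfun nu r.
  by apply: lt_le_trans (K1_le_hfun _ nuP _ r0); rewrite lt_neqAle eq_sym Kz.
have thE : theta r xi = normd xi ^+ 2 / (24 * D * D) * hfun nu r.
  by rewrite /theta sqr_normd.
have th0 : 0 < theta r xi.
  by rewrite thE mulr_gt0// divr_gt0 ?exprn_gt0// !mulr_gt0.
rewrite (eq_integral (fun t : measurableTypeR R =>
  (delta r xi)%:E * (t * expR (- (t * theta r xi)))%:E)%E); last first.
  by move=> t _; rewrite -EFinM; congr EFin; ring.
rewrite ge0_integralZl//; last 2 first.
- apply/measurable_EFinP; apply: measurable_funM; first exact: measurable_id.
  apply: (measurableT_comp (@measurable_expR R)).
  apply: (measurableT_comp (@oppr_measurable R setT)).
  by apply: measurable_funM => //; exact: measurable_id.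
- by move=> t t0; rewrite lee_fin mulr_ge0 ?expR_ge0.
apply: le_trans (lee_wpmul2l _ (integral_id_mul_expRN_le _ th0)) _; first by rewrite lee_fin.
rewrite -EFinM lee_fin thE /delta le_eqVlt; apply/orP; left; apply/eqP.
by field; rewrite !gt_eqF.
Qed.

(** The bound on P(X_t in B) is integrated in t, and Tonelli is applied only to its jointly
    measurable majorant [H], cut off to 0 for negative t. *)
Lemma Upot_box_le r : 0 < r ->
  (Upot mu (boxd n.+1 (r * (2 * D)^-1) (r * D^-1)) <=
   (gap^-1 * (24 * D ^+ 2 * (24 * D * D) ^+ 2) * hfun nu r ^- 2 * K1 nu r)%:E *
   \int[lam]_xi (trid n.+1 xi * normd xi ^- 5)%:E)%E.
Proof.
move=> r0; have K0 : 0 <= K1 nu r by exact: K1_ge0.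
have D0 : 0 < D by rewrite ltr0n.
have g0 : 0 < gap.
  by rewrite /box_gap !divr_gt0 ?mulr_gt0 ?invr_gt0 ?mulr_gt0 ?exprn_gt0.
set B := boxd _ _ _.
have dl0 xi : 0 <= delta r xi.
  by rewrite /delta mulr_ge0// divr_ge0 ?normd_ge0// mulr_ge0// sqr_ge0.
pose H (z : measurableTypeR R * Rd R n.+1) : \bar R := (if 0 <= z.1 then
  gap^-1 * (trid n.+1 z.2 * (z.1 * delta r z.2 * expR (- (z.1 * theta r z.2)))) else 0)%:E.
have mH : measurable_fun setT H.
  apply/measurable_EFinP; apply: measurable_fun_ifT => //.
    by apply: measurable_fun_ler => //; exact: measurable_fst.
  apply: measurable_funM => //; apply: measurable_funM; last exact: measurable_bound2.
  exact: (measurableT_comp (measurable_trid _) measurable_snd).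
have H0 z : (0 <= H z)%E.
  rewrite lee_fin; case: ifPn => // t0.
  apply: mulr_ge0; first by rewrite invr_ge0 ltW.
  exact: mulr_ge0 (trid_ge0 _ _) (mulr_ge0 (mulr_ge0 t0 (dl0 _)) (expR_ge0 _)).
apply: (@le_trans _ _ (\int[leb]_t \int[lam]_xi H (t, xi))%E).
  rewrite /Upot integral_mkcond; apply: ge0_le_integral_nonmeasurable => t _.
    exact: erestrict_ge0.
  rewrite patchE; case: ifPn => [/set_mem/= t0|_]; last exact: integral_ge0.
  have h := box_probability_le _ _ r0 t0.
  rewrite -[mu t B]mul1e -(mulVf (lt0r_neq0 g0)) EFinM -muleA.
  apply: le_trans (lee_wpmul2l _ h) _; first by rewrite lee_fin invr_ge0 ltW.
  rewrite -ge0_integralZl//; last 3 first.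
  - apply/measurable_EFinP; apply: measurable_funM; first exact: measurable_trid.
    exact: measurable_bound.
  - move=> xi _; rewrite lee_fin.
    exact: mulr_ge0 (trid_ge0 _ _) (mulr_ge0 (mulr_ge0 t0 (dl0 _)) (expR_ge0 _)).
  - by rewrite lee_fin invr_ge0 ltW.
  by rewrite le_eqVlt; apply/orP; left; apply/eqP; apply: eq_integral => xi _; rewrite /H /= t0.
rewrite fubini_tonelli//.
have n5 (xi : Rd R n.+1) : 0 <= normd xi ^- 5 by rewrite invr_ge0 exprn_ge0// normd_ge0.
have mn5 : measurable_fun setT (fun xi : Rd R n.+1 => (trid n.+1 xi * normd xi ^- 5)%:E).
  apply/measurable_EFinP; apply: measurable_funM; first exact: measurable_trid.
  under eq_fun do rewrite -exprVn -powR_inv1 ?normd_ge0//.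
  apply: measurable_funX; apply: (measurableT_comp (measurable_powR _)).
  exact: measurable_normd.
rewrite -ge0_integralZl//; last 2 first.
- by move=> xi _; rewrite lee_fin mulr_ge0 ?trid_ge0.
- by rewrite lee_fin !mulr_ge0 ?invr_ge0 ?sqr_ge0 ?exprn_ge0 ?(ltW g0).
apply: ge0_le_integral_nonmeasurable => xi _; first exact: integral_ge0.
have mI : measurable [set t : measurableTypeR R | 0 <= t].
  apply: (@measurable_set_bool _ (measurableTypeR R) (fun t => 0 <= t)).
  exact: measurable_fun_ler.
rewrite -EFinM.
apply: (@le_trans _ _ ((gap^-1 * trid n.+1 xi)%:E * \int[leb]_(t in [set t : R | (0 <= t)%R])
   (t * delta r xi * expR (- (t * theta r xi)))%:E)%E).
  rewrite [X in (_ * X)%E]integral_mkcond -ge0_integralZl//; last 3 first.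
  - apply/(measurable_restrictT _ mI); apply: measurable_funTS.
    apply/measurable_EFinP.
    exact: (measurableT_comp (measurable_bound2 r) (pair2_measurable xi)).
  - move=> t _; apply: erestrict_ge0 => s /= s0.
    by rewrite lee_fin; exact: mulr_ge0 (mulr_ge0 s0 (dl0 _)) (expR_ge0 _).
  - by rewrite lee_fin mulr_ge0 ?trid_ge0// invr_ge0 ltW.
  apply: ge0_le_integral_nonmeasurable => // t _; rewrite /H /= patchE.
  case: ifPn => [t0|/negP t0]; last by rewrite memNset ?mule0.
  by rewrite mem_set// -EFinM lee_fin; lra.
apply: le_trans (lee_wpmul2l _ (integral_bound_le r xi r0)) _.
  by rewrite lee_fin mulr_ge0 ?trid_ge0// invr_ge0 ltW.
rewrite -EFinM lee_fin le_eqVlt; apply/orP; left; apply/eqP; ring.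
Qed.

End process.

(** * From the potential of the box to the Green function *)

Lemma normd_gt0 (R : realType) m (x : Rd R m) : x <> zerod R m -> 0 < normd x.
Proof.
move=> x0; rewrite sqrtr_gt0 lt_neqAle dotd_ge0 andbT eq_sym.
apply/eqP => d0; apply: x0; elim: m x d0 => [|m ih] x /=.
  by move=> /eqP; rewrite mulf_eq0 orbb => /eqP.
move=> /eqP; rewrite paddr_eq0 ?dotd_ge0 -?expr2 ?sqr_ge0// => /andP[].
by rewrite sqrf_eq0 => /eqP h1 /eqP/ih h2; case: x h1 h2 => /= ? ? -> ->.
Qed.

(** Points of the box are nonzero and no farther out than [x], so [G] is at least [G x] on it. The
    integral of [G] over the box is the potential of the box without the null set [N], hence at most
    that of the box. *)
Lemma green_le_Upot_box (R : realType) m (mu : R -> probability (Rd R m) R)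
    (G : Rd R m -> \bar R) (x : Rd R m) (a b : R) :
  green_density mu G -> radial_nonincreasing G ->
  0 < a <= b -> m.+1%:R * (b * b) <= normd x ^+ 2 ->
  (G x * ((b - a) ^+ m.+1)%:E <= Upot mu (boxd m a b))%E.
Proof.
move=> [mG G0 [N [mN N0 GN]]] [_ Gdec] /andP[a0 ab] bx.
have mB := measurable_boxd m a b.
rewrite -lebd_boxd// -integral_cst//.
apply: (@le_trans _ _ (\int[lebd R m]_(y in boxd m a b) G y)%E).
  apply: ge0_le_integral_nonmeasurable => y yB; first exact: G0.
  have /andP[y0 yb] := boxd_normd _ _ _ _ a0 yB.
  apply: Gdec; first by rewrite sqrtr_gt0.
  rewrite -[leRHS]ger0_norm ?normd_ge0// -sqrtr_sqr ler_wsqrtr//.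
  exact: le_trans yb bx.
rewrite -GN//; apply: ge0_le_integral_nonmeasurable => t _; first exact: measure_ge0.
apply: le_measure; rewrite ?inE//; first exact: measurableD.
Qed.

Theorem mainTheorem18 (R : realType) (d : nat) :
  (6 <= d)%N ->
  exists C : R, 0 < C /\
    forall (nu : Rd R d.-1 -> R) (mu : R -> probability (Rd R d.-1) R)
           (G : Rd R d.-1 -> \bar R),
      iso_unimodal_levy_density nu ->
      levy_law nu mu ->
      green_density mu G ->
      radial_nonincreasing G ->
      forall x : Rd R d.-1, x <> zerod R d.-1 ->
        (G x <= (C * normd x ^- d * hfun nu (normd x) ^- 2
                   * K1 nu (normd x))%:E)%E.
Proof.
case: d => [|[|n]]// n4; rewrite -[n.+2.-1]/n.+1.
pose D : R := n.+2%:R.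
pose Z := fine (\int[lebd R n.+1]_xi (trid n.+1 xi * normd xi ^- 5)%:E)%E.
have D0 : 0 < D by rewrite ltr0n.
have g0 : 0 < box_gap R n.
  by rewrite /box_gap !divr_gt0 ?mulr_gt0 ?invr_gt0 ?mulr_gt0 ?exprn_gt0.
have i0 : (0 <= \int[lebd R n.+1]_xi (trid n.+1 xi * normd xi ^- 5)%:E)%E.
  apply: integral_ge0 => xi _.
  by rewrite lee_fin mulr_ge0 ?trid_ge0// invr_ge0 exprn_ge0// normd_ge0.
have ZE : (\int[lebd R n.+1]_xi (trid n.+1 xi * normd xi ^- 5)%:E = Z%:E)%E.
  by rewrite /Z fineK// ge0_fin_numE// integral_trid_normdV5_lty.
have Z0 : 0 <= Z by rewrite fine_ge0.
(* The box has side r/(2D); dividing by its volume produces r^-d and the factor (2D)^d with d = n +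
   2. *)
pose C1 := (box_gap R n)^-1 * (24 * D ^+ 2 * (24 * D * D) ^+ 2) * Z * (2 * D) ^+ n.+2.
have C10 : 0 <= C1.
  have [D0' g0'] := (ltW D0, ltW g0).
  have E0 : 0 <= (2 * D) ^+ n.+2 by rewrite exprn_ge0 ?mulr_ge0.
  have F0 : 0 <= 24 * D ^+ 2 * (24 * D * D) ^+ 2.
    by rewrite mulr_ge0 ?sqr_ge0// mulr_ge0 ?sqr_ge0.
  by rewrite /C1 mulr_ge0// mulr_ge0// mulr_ge0 ?invr_ge0.
(* [C1] is only shown to be nonnegative; adding 1 makes the constant positive. *)
exists (C1 + 1); split; first by lra.
move=> nu mu G nuP muP GP Gdec x x0.
have r0 : 0 < normd x by exact: normd_gt0.
set r := normd x in r0 *.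
have K0 : 0 <= K1 nu r by exact: K1_ge0.
have ab : 0 < r * (2 * D)^-1 <= r * D^-1.
  rewrite mulr_gt0 ?invr_gt0 ?mulr_gt0//= ler_wpM2l ?(ltW r0)//.
  by rewrite lef_pV2 ?posrE ?mulr_gt0//; lra.
have bx : n.+2%:R * (r * D^-1 * (r * D^-1)) <= normd x ^+ 2.
  rewrite -/D -/r; have -> : D * (r * D^-1 * (r * D^-1)) = r ^+ 2 * D^-1.
    by field; rewrite gt_eqF.
  by rewrite ler_piMr ?sqr_ge0// invf_le1// ler1n.
have := le_trans (green_le_Upot_box _ _ _ _ _ _ _ GP Gdec ab bx) (Upot_box_le _ _ nuP muP _ r0).
have -> : r * D^-1 - r * (2 * D)^-1 = r / (2 * D) by field; rewrite gt_eqF.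
have v0 : 0 < (r / (2 * D)) ^+ n.+2 by rewrite exprn_gt0// divr_gt0// mulr_gt0.
rewrite -lee_pdivlMr// ZE -!EFinM => h; apply: le_trans h _; rewrite lee_fin.
set h := hfun nu r ^- 2; have h0 : 0 <= h by rewrite invr_ge0 sqr_ge0.
have rn0 : 0 <= r ^- n.+2 by rewrite invr_ge0 exprn_ge0// ltW.
have -> : (box_gap R n)^-1 * (24 * D ^+ 2 * (24 * D * D) ^+ 2) * h * K1 nu r * Z
    / (r / (2 * D)) ^+ n.+2 = C1 * r ^- n.+2 * h * K1 nu r.
  rewrite expr_div_n [X in _ * X = _]invf_div /C1.
  by move: (r ^- n.+2) ((2 * D) ^+ n.+2) => p q; ring.
by rewrite !mulrDl lerDl !mulr_ge0.
Qed.
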